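(* Let $\Omega\subset\mathbb{R}^d$ be a bounded open set, $s\in(0,1)$, and $g\in H^{s,p}(\mathbb{R}^d)$, where $p>1$ is the exponent appearing below. Assume $f:\mathbb{R}^d\times\mathbb{R}\times\mathbb{R}^d\to\mathbb{R}$ is $\mathcal{L}^d\times\mathcal{B}$ measurable, $f(x,\cdot,\cdot)$ is lower semicontinuous for $\mathcal{L}^d$-almost every $x\in\mathbb{R}^d$, and $f(x,z,\cdot)$ is convex for $\mathcal{L}^d$-almost every $x\in\mathbb{R}^d$ and all $z\in\mathbb{R}$. Further assume that $f$ satisfies the coercivity condition $$f(x,z,\xi)\ge a(x)+b|\xi|^p$$ for almost every $x\in\mathbb{R}^d$, for every $(z,\xi)\in\mathbb{R}\times\mathbb{R}^d$, and for some $a\in L^1(\mathbb{R}^d)$, $b>0$, and $p>1$. Define $F_s(u)=\int_{\mathbb{R}^d}f(x,u,D^su)\,dx$ and assume that $F_s(u_0)$ is finite for some $u_0\in H^{s,p}_g(\Omega)$. Additionally assume the growth conditions $$|f(x,z,\xi)|\le C(|z|^p+|\xi|^p)+\gamma_1(x),$$ $$|D_zf(x,z,\xi)|\le C(|z|^{p-1}+|\xi|^{p-1})+\gamma_2(x),$$ $$|D_\xi f(x,z,\xi)|\le C(|z|^{p-1}+|\xi|^{p-1})+\gamma_3(x),$$ where $\gamma_1,\gamma_2,\gamma_3\in L^{p/(p-1)}(\mathbb{R}^d)$. Further suppose that $u$ is a minimizer of $F_s$ over $H^{s,p}_g(\Omega)$. Then $u$ satisfies $$\int_{\mathbb{R}^d}D_zf(x,u,D^su)\,\varphi+D_\xi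 f(x,u,D^su)\cdot D^s\varphi\,dx=0$$ for all $\varphi\in C_c^\infty(\Omega)$.
   Context: $\mathcal{L}^d$ is the Lebesgue measure on $\mathbb{R}^d$, and $\mathcal{L}^d\times\mathcal{B}$ measurable means measurable with respect to the product of the Lebesgue $\sigma$-algebra on $\mathbb{R}^d$ (variable $x$) and the Borel $\sigma$-algebra in the variables $(z,\xi)$. $D_zf$ and $D_\xi f$ denote the partial derivative in $z\in\mathbb{R}$ and the gradient in $\xi\in\mathbb{R}^d$ of $f(x,z,\xi)$; $C$ is a constant. Fractional gradient: for $s\in(0,1)$ and $\varphi\in C_c^\infty(\mathbb{R}^d)$, $$D^s\varphi(x)=c_{d,s}\int_{\mathbb{R}^d}\frac{\varphi(x)-\varphi(y)}{|x-y|^{d+s}}\,\frac{x-y}{|x-y|}\,dy,\qquad c_{d,s}=\frac{-d+1-s}{\gamma(1-s)},\quad \gamma(\alpha)=\frac{\pi^{d/2}2^\alpha\Gamma(\alpha/2)}{\Gamma(\frac{d-\alpha}{2})}.$$ For $u\in L^p(\mathbb{R}^d)$, $D^su$ is understood in the distributional sense: $D^su\in L^p(\mathbb{R}^d;\mathbb{R}^d)$ means that there is such a field with $\int(D^su)_i\,\varphi\,dx=-\int u\,(D^s\varphi)_i\,dx$ for all $\varphi\in C_c^\infty(\mathbb{R}^d)$, $i=1,\dots,d$. Spaces: $H^{s,p}(\mathbb{R}^d)=\{u\in L^p(\mathbb{R}^d):D^su\in L^p(\mathbb{R}^d;\mathbb{R}^d)\}$, and $H^{s,p}_g(\Omega)=\{u\in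 H^{s,p}(\mathbb{R}^d):u\equiv g\text{ in }\Omega^c\}$. *)

(* Defs.v *)
From HB Require Import structures.
From mathcomp Require Import all_boot all_order all_algebra.
From mathcomp Require Import all_classical all_reals all_analysis.

Set Implicit Arguments.
Unset Strict Implicit.
Unset Printing Implicit Defensive.
Import Order.TTheory GRing.Theory Num.Theory.
Import numFieldNormedType.Exports.

Local Open Scope classical_set_scope.
Local Open Scope ring_scope.

(* Throughout, R^d is 'rV[R]_d with d = n.+1. The norm `|x| that the library
   puts on row vectors is the maximum norm; the Euclidean norm is enorm.
   Topology, boundedness and differentiability do not depend on the choice. *)

Section euclidean.
Context {R : realType} {n : nat}.
Implicit Types x y : 'rV[R]_n.+1.

Definition dotv x y : R := \sum_i x 0 i * y 0 i.

Definition enorm x : R := Num.sqrt (dotv x x).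

Definition partial (i : 'I_n.+1) (h : 'rV[R]_n.+1 -> R) : 'rV[R]_n.+1 -> R :=
  fun x => 'D_(delta_mx 0 i) h x.

Definition grad (h : 'rV[R]_n.+1 -> R) x : 'rV[R]_n.+1 :=
  \row_i partial i h x.

(* C^oo: every iterated partial derivative is differentiable everywhere *)
Definition smooth (phi : 'rV[R]_n.+1 -> R) :=
  forall (l : seq 'I_n.+1) x, differentiable (foldr partial phi l) x.

(* C_c^oo(Omega) *)
Definition test_function (Omega : set 'rV[R]_n.+1) (phi : 'rV[R]_n.+1 -> R) :=
  [/\ smooth phi,
      compact (closure [set x | phi x != 0]) &
      closure [set x | phi x != 0] `<=` Omega].

End euclidean.

Section lebesgue_outer_measure.
Context (R : realType) (n : nat).
Local Notation E := 'rV[R]_n.+1.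

(* A box is given by its two corners; it is empty, and has volume 0, as soon
   as b 0 i <= a 0 i for some i. *)
Definition box (ab : E * E) : set E :=
  [set x | forall i, ab.1 0 i < x 0 i <= ab.2 0 i].

Definition box_vol (ab : E * E) : R :=
  \prod_i Num.max 0 (ab.2 0 i - ab.1 0 i).

Local Open Scope ereal_scope.

Definition box_cover (A : set E) : set (nat -> E * E) :=
  [set B | A `<=` \bigcup_k box (B k)].

Definition leb_outer (A : set E) : \bar R :=
  ereal_inf [set \sum_(k <oo) (box_vol (B k))%:E | B in box_cover A].

Lemma box_vol_ge0 ab : 0 <= (box_vol ab)%:E.
Proof. by rewrite lee_fin prodr_ge0// => i _; rewrite le_max lexx. Qed.

Lemma leb_outer0 : leb_outer set0 = 0.
Proof.
apply/eqP; rewrite eq_le; apply/andP; split; last first.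
  by apply: le_ereal_inf_tmp => _ [B _ <-]; apply: nneseries_ge0 => k _ _;
     exact: box_vol_ge0.
apply: ereal_inf_lbound; exists (fun=> (0%R, 0%R)); first by move=> x [].
apply: eseries0 => k _ _; congr (_%:E).
by rewrite /box_vol big_ord_recl/= subrr maxxx mul0r.
Qed.

Lemma leb_outer_ge0 A : 0 <= leb_outer A.
Proof.
apply: le_ereal_inf_tmp => _ [B _ <-]; apply: nneseries_ge0 => k _ _.
exact: box_vol_ge0.
Qed.

Lemma le_leb_outer : {homo leb_outer : A B / A `<=` B >-> A <= B}.
Proof.
move=> A B AB; apply/ereal_inf_le_tmp => _ [F BF <-].
by exists F => //; exact: subset_trans AB BF.
Qed.

Lemma leb_outer_sigma_subadditive : sigma_subadditive leb_outer.
Proof.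
move=> A; have [[i ioo]|] := pselect (exists i, leb_outer (A i) = +oo).
  rewrite (eseries_pinfty _ _ ioo) ?leey// => k _.
  by rewrite -ltNye (lt_le_trans _ (leb_outer_ge0 _)).
rewrite -forallNE => Aoo.
suff add2e (e : {posnum R}) :
    leb_outer (\bigcup_k A k) <= \sum_(i <oo) leb_outer (A i) + e%:num%:E.
  by apply/lee_addgt0Pr => _/posnumP[].
rewrite (le_trans _ (epsilon_trick _ _ _))//; last first.
  by move=> k; exact: leb_outer_ge0.
pose P k (B : nat -> E * E) := box_cover (A k) B /\
  \sum_(j <oo) (box_vol (B j))%:E <=
    leb_outer (A k) + (e%:num / (2 ^ k.+1)%:R)%:E.
have [G PG] : {G : nat -> nat -> E * E & forall k, P k (G k)}.
  apply: (@choice _ _ P) => k; rewrite /P.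
  have Afin : leb_outer (A k) \is a fin_num.
    by rewrite ge0_fin_numE ?leb_outer_ge0// ltey; exact/eqP/Aoo.
  have en1 : (0 < e%:num / (2 ^ k.+1)%:R :> R)%R by [].
  have [_ [B AB <-] /ltW BA] := lb_ereal_inf_adherent en1 Afin.
  by exists B.
pose W ij := (box_vol (uncurry G ij))%:E.
have W_ge0 ij : 0 <= W ij by exact: box_vol_ge0.
have /card_esym/ppcard_eqP[f] := card_nat2.
apply: (@le_trans _ _ (\esum_(i in setT) W i)).
  apply: ereal_inf_lbound => /=; exists (uncurry G \o f).
    move=> t [i _ /(PG i).1[j _ Gt]].
    by exists (f^-1%FUN (i, j)) => //=; rewrite invK ?inE.
  rewrite -(esum_pred_image W _ xpredT) ?[fun=> _]set_true//.
  by rewrite image_eq.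
rewrite (_ : esum _ _ =
    \sum_(i <oo) \sum_(j <oo) (box_vol (G i j))%:E); last first.
  pose J : nat -> set (nat * nat) := fun i => [set (i, j) | j in setT].
  rewrite (_ : setT = \bigcup_k J k); last first.
    by rewrite predeqE => -[a b]; split => // _; exists a => //; exists b.
  rewrite esum_bigcupT /=; last 2 first.
    - apply/trivIsetP => i j _ _ ij.
      rewrite predeqE => -[k m] /=; split => //= -[] [_] _ [<-{k} _].
      by move=> [m' _] [] /esym/eqP; rewrite (negbTE ij).
    - by [].
  rewrite -(image_id [set: nat]) -fun_true esum_pred_image//; last first.
    by move=> k _; exact: esum_ge0.
  apply: eq_eseriesr => /= j _.
  rewrite -(esum_pred_image W (pair j) predT)//=; last first.
    by move=> ? ? _ _; exact: (@can_inj _ _ _ snd).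
  by congr esum; rewrite predeqE => -[a b]; split; move=> [i _ <-]; exists i.
apply: lee_nneseries => [k _ _|k _]; last exact: (PG k).2.
by apply: nneseries_ge0 => j _ _; exact: box_vol_ge0.
Qed.

HB.instance Definition _ := isOuterMeasure.Build R E leb_outer
  leb_outer0 leb_outer_ge0 le_leb_outer leb_outer_sigma_subadditive.

End lebesgue_outer_measure.

Definition leb_outer_measure (R : realType) (n : nat) :
  {outer_measure set 'rV[R]_n.+1 -> \bar R} := @leb_outer R n.

(* R^d with the sigma-algebra of Lebesgue (i.e. Caratheodory) measurable sets *)
Notation lebRd R n := (caratheodory_type (leb_outer_measure R n)).

Definition leb (R : realType) (n : nat) : {measure set (lebRd R n) -> \bar R} :=
  (leb_outer_measure R n : set (lebRd R n) -> \bar R).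

(* R x R^d with its Borel sigma-algebra *)
Notation borelRRd R n := (g_sigma_algebraType (@open (R * 'rV[R]_n.+1)%type)).

Section fractional_gradient.
Context {R : realType} {n : nat}.
Local Notation E := 'rV[R]_n.+1.
Local Notation d := (n.+1%:R : R).
Local Notation mu := (leb R n).
Implicit Types (s p : R) (u g phi : E -> R) (v : E -> E).

(* Euler's Gamma function, for x > 0 *)
Definition Gamma (x : R) : R :=
  \int[lebesgue_measure]_(t in `]0, +oo[) (t `^ (x - 1) * expR (- t)).

Definition riesz_gamma (alpha : R) : R :=
  pi `^ (d / 2) * 2 `^ alpha * Gamma (alpha / 2) / Gamma ((d - alpha) / 2).

Definition frac_const s : R := (- d + 1 - s) / riesz_gamma (1 - s).

(* The integrand takes the value 0 at y = x, as 0^-1 = 0. *)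
Definition frac_grad s phi (x : E) : E :=
  \row_i (frac_const s *
    \int[mu]_y ((phi x - phi y) / enorm (x - y) `^ (d + s) *
                ((x - y) 0 i / enorm (x - y)))).

(* v is a representative of the distributional D^s u, and is in L^p(R^d; R^d) *)
Definition is_frac_grad s p u v :=
  (forall i, (fun x => v x 0 i) \in Lfun mu p%:E) /\
  (forall phi, test_function setT phi -> forall i,
    \int[mu]_x (v x 0 i * phi x) = - \int[mu]_x (u x * frac_grad s phi x 0 i)).

Definition Hsp s p : set (E -> R) :=
  [set u | u \in Lfun mu p%:E /\ exists v, is_frac_grad s p u v].

Definition Hspg s p (Omega : set E) g : set (E -> R) :=
  [set u | Hsp s p u /\ {ae mu, forall x, ~ Omega x -> u x = g x}].

(* F_s(u), where Du is a representative of D^s u *)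
Definition Fs (f : E -> R -> E -> R) u (Du : E -> E) : \bar R :=
  (\int[mu]_x (f x (u x) (Du x))%:E)%E.

(* D^s u being defined up to a null set, minimality is expressed with all its
   representatives, and likewise for the competitors. *)
Definition is_minimizer s p (Omega : set E) g (f : E -> R -> E -> R) u :=
  Hspg s p Omega g u /\
  forall Du w Dw, is_frac_grad s p u Du ->
    Hspg s p Omega g w -> is_frac_grad s p w Dw ->
    (Fs f u Du <= Fs f w Dw)%E.

End fractional_gradient.

(* Main.v *)
Require Import Defs.
From HB Require Import structures.
From mathcomp Require Import all_boot all_order all_algebra.
From mathcomp Require Import all_classical all_reals all_analysis.
From mathcomp Require Import measurable_realfun.
From mathcomp Require Import ring lra.

(** Minimality is tested against u + t phi for small t of either sign. These are
    competitors because phi vanishes outside Omega and because the fractional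
    gradient of phi, given by a singular integral, is also its distributional
    fractional gradient and lies in L^p.

    The last fact is where the fractional calculus enters. A test function
    phi is Lipschitz, bounded and of bounded support, so
    (phi(x) - phi(y)) kappa(y - x), where kappa is the odd vector kernel of size
    |z|^-(d+s), is absolutely integrable on the product of two copies of
    R^d: near the diagonal the increment gains a factor |x - y|, and
    min(|z|, 1) |z|^-(d+s) is integrable, as a sum over dyadic shells shows
    (integral_kern_lty, fdiff_integrable). Hence the fractional gradient is bounded and
    integrable, so it lies in every L^r (fgrad_Lfun). Integration by parts
    (fgrad_antisymmetric) reduces, by exchanging x and y, to the vanishing of the
    double integral of (Phi(x) - Phi(y)) kappa(y - x) for Phi = phi psi, which
    follows from Fubini and the translation invariance of Lebesgue measure.
    The properties of Lebesgue measure that are used (Borel sets are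
    measurable, translation invariance, finiteness on balls) are
    read off its definition by covers by boxes.

    It remains to differentiate F_s(u + t phi) at t = 0 under the integral. The
    value F_s(u) is finite by coercivity and comparison with u_0. The
    difference quotients of the integrand are dominated by an integrable
    function, by the mean value theorem in z and in xi separately and the growth
    conditions on the two derivatives (increment_le). They converge pointwise to
    D_z f phi + D_xi f . D^s phi: although f is only assumed differentiable in z and
    in xi separately, its convexity in xi makes it differentiable along rays
    (chain_rule_along_ray). Dominated convergence then shows that
    the integral of the limit is nonnegative, and replacing phi by - phi that it is
    nonpositive. *)

Set Implicit Arguments.
Unset Strict Implicit.
Unset Printing Implicit Defensive.
Import Order.TTheory GRing.Theory Num.Theory.
Import numFieldNormedType.Exports.

Local Open Scope classical_set_scope.
Local Open Scope ring_scope.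

(** * Lebesgue measure on R^d *)

Section lebesgue_facts.
Context {R : realType} {n : nat}.
Local Notation E := 'rV[R]_n.+1.
Local Notation mu := (leb R n).
Implicit Types (x y z v : E) (A X : set E).

Lemma le_rnorm x (r : R) : 0 <= r -> (forall i, `|x 0 i| <= r) -> `|x| <= r.
Proof.
move=> r0 xr; rewrite /Num.norm/= mx_normrE.
apply/bigmax_leP; split=> //= -[i j] _ /=.
by rewrite ord1 xr.
Qed.

Lemma coord_le_rnorm x i : `|x 0 i| <= `|x|.
Proof.
rewrite [leRHS]/Num.norm/= mx_normrE.
by apply: (le_trans _ (le_bigmax _ _ (0, i))).
Qed.

Lemma box_vol_split (ab : E * E) i (c : R) :
  box_vol (ab.1, \row_j if j == i then Num.min (ab.2 0 j) c else ab.2 0 j) +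
  box_vol (\row_j if j == i then Num.max (ab.1 0 j) c else ab.1 0 j, ab.2)
  = box_vol ab.
Proof.
rewrite /box_vol/= (bigD1 i)//= [X in _ + X](bigD1 i)//= [RHS](bigD1 i)//=.
rewrite !mxE eqxx.
under eq_bigr => j /negPf ji do rewrite !mxE ji.
under [X in _ + _ * X]eq_bigr => j /negPf ji do rewrite !mxE ji.
rewrite -mulrDl; congr (_ * _).
rewrite !maxEle !minEle; repeat case: ifP => //; lra.
Qed.

(** A half-space cuts every box of a cover into two boxes whose volumes add up
    to that of the box, so it splits the outer measure of any set. This is
    the only place where a set is shown to be Caratheodory measurable by hand:
    the measurability of the coordinates, of open sets and of continuous functions
    is derived from it. *)
Lemma halfspace_caratheodory i (c : R) :
  (leb_outer_measure R n).-caratheodory [set x : E | x 0 i <= c].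
Proof.
apply: le_caratheodory_measurable => X.
apply: le_ereal_inf_tmp => _ [B XB <-].
pose B1 k := ((B k).1,
  \row_j if j == i then Num.min ((B k).2 0 j) c else (B k).2 0 j) : E * E.
pose B2 k := (\row_j if j == i then Num.max ((B k).1 0 j) c else (B k).1 0 j,
  (B k).2) : E * E.
have -> : (\sum_(k <oo) (box_vol (B k))%:E =
  \sum_(k <oo) (box_vol (B1 k))%:E + \sum_(k <oo) (box_vol (B2 k))%:E)%E.
  rewrite -nneseriesD; try by move=> *; exact: box_vol_ge0.
  by apply: eq_eseriesr => k _; rewrite -EFinD box_vol_split.
apply: leeD; apply: ereal_inf_lbound => /=.
- exists B1 => // x [Xx xc]; have [k _ Bx] := XB _ Xx.
  exists k => // j /=; rewrite mxE; have /andP[-> xj]/= := Bx j.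
  case: eqVneq => // ji; rewrite ji in xj *.
  by rewrite le_min xj.
- exists B2 => // x [Xx /= xc]; have [k _ Bx] := XB _ Xx.
  exists k => // j /=; rewrite mxE; have /andP[jx ->]/= := Bx j.
  rewrite andbT; case: eqVneq => // ji; rewrite ji in jx *.
  by rewrite gt_max jx ltNge; apply/negP.
Qed.

Lemma measurable_coord i : measurable_fun setT (fun x : lebRd R n => x 0 i).
Proof.
apply: (measurability _ (RGenOInfty.measurableE R)) => _ [_ [r ->] <-].
rewrite setTI (_ : _ @^-1` _ = ~` [set x : E | x 0 i <= r]).
  by apply: measurableC; exact: halfspace_caratheodory.
apply/seteqP; split => x /=; rewrite in_itv/= andbT ltNge; first by move/negP.
by move=> H; apply/negP.
Qed.

End lebesgue_facts.

Section measurability_by_coordinates.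
Context {R : realType} {n : nat} d (T : measurableType d).
Local Notation E := 'rV[R]_n.+1.

(** R x R^d is second countable: an open set is the union of the balls with
    rational centre and radius 1/(k+1) that it contains, and the preimage of
    such a ball is cut out by finitely many conditions on the coordinates. *)
Lemma measurable_preimage_open (u : T -> R) (v : T -> E) (O : set (R * E)) :
  measurable_fun setT u -> (forall i, measurable_fun setT (fun t => v t 0 i)) ->
  open O -> measurable [set t | O (u t, v t)].
Proof.
move=> mu mv oO.
pose ctr (q : rat * 'rV[rat]_n.+1) : R * E := (ratr q.1, \row_j ratr (q.2 0 j)).
pose e (k : nat) : R := k.+1%:R^-1.
have e0 k : 0 < e k by rewrite invr_gt0 ltr0n.
pose I := [set w : (rat * 'rV[rat]_n.+1) * nat | ball (ctr w.1) (e w.2) `<=` O].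
rewrite (_ : [set t | O (u t, v t)] = \bigcup_(w in I)
  [set t | ball (ctr w.1) (e w.2) (u t, v t)]); last first.
  apply/seteqP; split => t /=; last by move=> [w Iw]; exact: Iw.
  move=> Ot; have /nbhs_ballP[r/= r0 rO] : nbhs (u t, v t) O.
    by apply: open_nbhs_nbhs.
  have [k kr] : exists k, e k < r / 2.
    have := @near_infty_natSinv_lt R (PosNum (divr_gt0 r0 (ltr0n _ 2))).
    by move=> [k _ /(_ k (leqnn k))]; exists k.
  have H (y : R) : exists q : rat, ball (ratr q : R) (e k) y.
    have : y - e k < y + e k by rewrite ltrBlDr; have := e0 k; lra.
    move=> /rat_in_itvoo[q]; rewrite in_itv/= => /andP[q1 q2].
    by exists q; rewrite /ball/= ltr_norml; apply/andP; split; lra.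
  have [q0 q0P] := H (u t).
  have /choice[q qP] := fun j => H (v t 0 j).
  have cb : ball (ctr (q0, \row_j q j)) (e k) (u t, v t).
    split => //=; split=> // i j; rewrite !mxE ord1; exact: qP.
  exists ((q0, \row_j q j), k) => //=.
  move=> w /= wb; apply: rO.
  apply: (@le_ball _ _ _ (e k + e k)); first by rewrite ltW//; lra.
  by apply: ball_triangle wb; apply: ball_sym.
rewrite bigcup_mkcond; apply: countable_bigcupT_measurable => [|w]; first exact: countableP.
case: ifPn => // _.
rewrite (_ : mkset _ = [set t | ball ((ctr w.1).1) (e w.2) (u t)] `&`
  \bigcap_(j in [set: 'I_n.+1]) [set t | ball ((ctr w.1).2 0 j) (e w.2) (v t 0 j)]).
  have mb (c r : R) (f : T -> R) : measurable_fun setT f ->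
      measurable [set t | ball c r (f t)].
    move=> mf; rewrite -[X in measurable X]setTI; apply: mf => //.
    by apply: open_measurable; exact: ball_open.
  apply: measurableI; first exact: mb.
  by apply: fin_bigcap_measurable => // j _; exact: mb.
apply/seteqP; split => t /=.
  by move=> [tu [_ tv]]; split => // j _ /=; exact: tv.
by move=> [tu tv]; split => //; split => // i j; rewrite ord1; exact: tv.
Qed.

Lemma measurable_pair_borel (u : T -> R) (v : T -> E) :
  measurable_fun setT u -> (forall i, measurable_fun setT (fun t => v t 0 i)) ->
  measurable_fun setT ((fun t => (u t, v t)) : T -> borelRRd R n).
Proof.
move=> mu mv.
apply: (@measurability _ _ T (borelRRd R n) setT _ (@open (R * E)%type)) => // _ [U oU <-].
by rewrite setTI; exact: measurable_preimage_open.
Qed.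

(** Stated for maps given by measurable coordinates rather than for the
    identity of R^d, in order to apply to x + z and y - x as functions of a
    pair of points. *)
Lemma measurable_continuous_comp (g : E -> R) (v : T -> E) :
  continuous g -> (forall i, measurable_fun setT (fun t => v t 0 i)) ->
  measurable_fun setT (g \o v).
Proof.
move=> cg mv; apply: (measurability _ (RGenOpens.measurableE R)) => _ [_ [a [b ->]] <-].
rewrite setTI.
have := @measurable_preimage_open (cst 0) v ((g \o snd) @^-1` `]a, b[).
apply => //; apply: open_comp; last exact: interval_open.
move=> -[c x] _.
by apply: (@continuous_comp _ _ _ snd g); [exact: cvg_snd | exact: cg].
Qed.

End measurability_by_coordinates.

(** ** Translation invariance *)

Section measure_preserving.
Context d (T : measurableType d) (R : realType).
Context (m : {measure set T -> \bar R}) (phi : T -> T).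
Hypothesis mphi : measurable_fun setT phi.
Hypothesis phiE : forall A, measurable A -> pushforward m phi A = m A.

Lemma ge0_integral_measure_preserving (f : T -> \bar R) :
  measurable_fun setT f -> (forall x, 0 <= f x)%E ->
  (\int[m]_x f (phi x) = \int[m]_x f x)%E.
Proof.
move=> mf f0.
rewrite -(@ge0_integral_pushforward _ _ _ _ _ _ mphi m setT f)//.
by apply: eq_measure_integral => // A mA _; rewrite -phiE.
Qed.

Lemma integral_measure_preserving (f : T -> \bar R) :
  measurable_fun setT f -> (\int[m]_x f (phi x) = \int[m]_x f x)%E.
Proof.
move=> mf; rewrite integralE [RHS]integralE; congr (_ - _)%E.
- have mf' : measurable_fun setT (f^\+)%E by exact: measurable_funepos.
  rewrite -(ge0_integral_measure_preserving mf')//.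
  by rewrite -[fun x => f _]/(f \o phi) funepos_comp.
- have mf' : measurable_fun setT (f^\-)%E by exact: measurable_funeneg.
  rewrite -(ge0_integral_measure_preserving mf')//.
  by rewrite -[fun x => f _]/(f \o phi) funeneg_comp.
Qed.

Lemma integrable_measure_preserving (f : T -> \bar R) :
  m.-integrable setT f -> m.-integrable setT (fun x => f (phi x)).
Proof.
move=> /integrableP[mf fi]; apply/integrableP; split.
  exact: (measurableT_comp mf).
rewrite (@ge0_integral_measure_preserving (fun x => `|f x|)%E)//.
exact: measurableT_comp.
Qed.

End measure_preserving.

Section lebesgue_measure_facts.
Context {R : realType} {n : nat}.
Local Notation E := 'rV[R]_n.+1.
Local Notation mu := (leb R n).
Local Notation rball r := [set x : E | (`|x| < r)%R].
Implicit Types (x y z v : E) (A X : set E).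

Lemma continuous_measurable_leb (g : E -> R) :
  continuous g -> measurable_fun setT (g : lebRd R n -> R).
Proof.
by move=> cg; apply: (measurable_continuous_comp cg) => i; exact: measurable_coord.
Qed.

Lemma measurable_rnorm : measurable_fun setT (fun x : lebRd R n => `|x|).
Proof. by apply: continuous_measurable_leb => x; exact: norm_continuous. Qed.

Lemma measurable_rball (r : R) : measurable (rball r : set (lebRd R n)).
Proof.
rewrite (_ : mkset _ = (fun x : lebRd R n => `|x|) @^-1` `]-oo, r[).
  by rewrite -[X in measurable X]setTI; apply: measurable_rnorm.
by apply/seteqP; split => x; rewrite /= in_itv.
Qed.

(** A ball of the maximum norm is contained in a single cube of side 2 r. *)
Lemma leb_rball_le (r : R) : 0 <= r ->
  (mu (rball r) <= ((2 * r) ^+ n.+1)%:E)%E.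
Proof.
move=> r0; apply: ge_ereal_inf.
pose B k : E * E := if k is 0%N then (const_mx (- r), const_mx r) else (0, 0).
exists (\sum_(k <oo) (box_vol (B k))%:E)%E.
  exists B => // x /= xr; exists 0%N => // i /=; rewrite !mxE.
  have := le_lt_trans (coord_le_rnorm x i) xr.
  by rewrite ltr_norml => /andP[-> /ltW ->].
rewrite nneseries_recl//; last by move=> *; exact: box_vol_ge0.
rewrite eseries0 ?adde0; last first.
  move=> [|k] // _ _; congr (_%:E).
  by rewrite /box_vol big_ord_recl/= subrr maxxx mul0r.
rewrite lee_fin /box_vol/=.
under eq_bigr do rewrite !mxE opprK.
rewrite prodr_const card_ord.
by rewrite max_r; [rewrite mulrDl mul1r|rewrite addr_ge0].
Qed.

Lemma leb_rball_lty (r : R) : (mu (rball r) < +oo)%E.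
Proof.
have [r0|r0] := leP 0 r; first exact: le_lt_trans (leb_rball_le r0) (ltry _).
rewrite (_ : mkset _ = set0) ?measure0//; apply/seteqP; split => x //= xr.
by have := lt_trans xr r0; rewrite normr_lt0.
Qed.

Lemma leb_sigma_finite : sigma_finite setT mu.
Proof.
exists (fun k => rball k%:R).
  apply/seteqP; split => // x _; exists (Num.truncn `|x|).+1 => //=.
  exact: truncnS_gt.
by move=> k; split; [exact: measurable_rball | exact: leb_rball_lty].
Qed.

(** Lebesgue measure together with its sigma-finiteness, as Tonelli and Fubini
    expect it. *)
Definition leb_sf : {sigma_finite_measure set (lebRd R n) -> \bar R} :=
  @SigmaFiniteMeasure.Pack _ _ _ mu (SigmaFiniteMeasure.Class
    (Measure.measure_function_Content_isMeasure_mixin (Measure.class mu))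
    (isSFinite.Axioms_ _ _ mu (sfinite_measure_sigma_finite leb_sigma_finite))
    (isSigmaFinite.Axioms_ _ _ mu leb_sigma_finite)).

(** Translating a cover by boxes yields a cover of the translated set by boxes
    of the same volumes; the opposite inequality is the translation by - v. *)
Lemma leb_outer_translate_le v A :
  (leb_outer [set x | A (x + v)%R] <= leb_outer A)%E.
Proof.
apply: le_ereal_inf_tmp => _ [B AB <-]; apply: ereal_inf_lbound.
exists (fun k => ((B k).1 - v, (B k).2 - v)).
  move=> x /= /AB[k _ Bk]; exists k => // i /=.
  by have := Bk i; rewrite !mxE lerBrDr ltrBlDr.
apply: eq_eseriesr => k _; congr (_%:E); apply: eq_bigr => i _ /=.
by rewrite !mxE opprD opprK addrACA addNr addr0.
Qed.

Lemma leb_outer_translate v A : leb_outer [set x | A (x + v)%R] = leb_outer A.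
Proof.
apply/eqP; rewrite eq_le leb_outer_translate_le/=.
have := leb_outer_translate_le (- v) [set x | A (x + v)%R].
by rewrite (_ : mkset (fun x => _ (x - v)) = A)//; apply/seteqP; split => x /=;
  rewrite subrK.
Qed.

Lemma measurable_translate v :
  measurable_fun setT ((fun x => x + v) : lebRd R n -> lebRd R n).
Proof.
move=> _ A mA; rewrite setTI.
suff : (leb_outer_measure R n).-caratheodory [set x : E | A (x + v)] by [].
have {}mA : (leb_outer_measure R n).-caratheodory A by [].
move=> X.
rewrite -[LHS](leb_outer_translate (- v)) [LHS]mA.
by congr (_ + _)%E; rewrite -[LHS](leb_outer_translate v); congr leb_outer;
  apply/seteqP; split => x /=; rewrite addrK.
Qed.

Lemma pushforward_translate v A :
  pushforward mu ((fun x => x + v) : lebRd R n -> lebRd R n) A = mu A.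
Proof. exact: leb_outer_translate. Qed.

Lemma ge0_integral_translate v (f : lebRd R n -> \bar R) :
  measurable_fun setT f -> (forall x, 0 <= f x)%E ->
  (\int[mu]_x f (x + v)%R = \int[mu]_x f x)%E.
Proof.
exact: (ge0_integral_measure_preserving (measurable_translate v)
  (fun A _ => pushforward_translate v A)).
Qed.

Lemma integral_translate v (f : lebRd R n -> \bar R) :
  measurable_fun setT f -> (\int[mu]_x f (x + v)%R = \int[mu]_x f x)%E.
Proof.
exact: (integral_measure_preserving (measurable_translate v)
  (fun A _ => pushforward_translate v A)).
Qed.

Lemma integrable_translate v (f : lebRd R n -> \bar R) :
  mu.-integrable setT f -> mu.-integrable setT (fun x => f (x + v)).
Proof.
exact: (integrable_measure_preserving (measurable_translate v)
  (fun A _ => pushforward_translate v A)).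
Qed.

End lebesgue_measure_facts.

(** * An integrable majorant of the fractional kernel *)

Lemma nneseries_geometric_lty (R : realType) (C q : R) : 0 <= C -> 0 <= q < 1 ->
  (\sum_(k <oo) (C * q ^+ k)%:E < +oo)%E.
Proof.
move=> C0 /andP[q0 q1].
apply: (@le_lt_trans _ _ (C * (1 - q)^-1)%:E); last exact: ltry.
apply: lime_le.
  by apply: is_cvg_nneseries => k _ _; rewrite lee_fin mulr_ge0// exprn_ge0.
apply: nearW => N; rewrite sumEFin lee_fin.
rewrite -[leLHS]/(series (geometric C q) N) geometric_seriesE ?lt_eqF//.
rewrite ler_wpM2r ?invr_ge0 ?subr_ge0 1?(ltW q1)//.
by rewrite ler_piMr// lerBlDr lerDl exprn_ge0.
Qed.

Section dyadic_domination.
Context d (T : measurableType d) (R : realType) (m : {measure set T -> \bar R}).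

(** The function f is at most c k on the set A k, whose measure is at most v k,
    and the sets A k cover the set where f is positive. Comparing f with the
    sum of the c k 1_(A k) bounds its integral by a geometric series. *)
Lemma integral_lty_geometric (f : T -> R) (A : nat -> set T) (c v : nat -> R)
    (C q : R) :
  measurable_fun setT f -> (forall x, 0 <= f x) ->
  (forall k, measurable (A k)) -> (forall k, 0 <= c k) ->
  (forall k, (m (A k) <= (v k)%:E)%E) ->
  (forall x, f x <= 0 \/ exists2 k, A k x & f x <= c k) ->
  0 <= C -> 0 <= q < 1 -> (forall k, c k * v k <= C * q ^+ k) ->
  (\int[m]_x (f x)%:E < +oo)%E.
Proof.
move=> mf f0 mA c0 Av fA C0 q01 cv.
have mI k : measurable_fun setT (fun x => (c k * \1_(A k) x)%:E).
  by apply/measurable_EFinP; apply: measurable_funM => //; exact: measurable_indic.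
have I0 k x : (0 <= (c k * \1_(A k) x)%:E)%E by rewrite lee_fin mulr_ge0.
apply: (@le_lt_trans _ _ (\int[m]_x \sum_(k <oo) (c k * \1_(A k) x)%:E)%E).
  apply: ge0_le_integral => //.
  - by move=> x _; rewrite lee_fin.
  - exact/measurable_EFinP.
  - by apply: ge0_emeasurable_sum.
  - move=> x _; have [fx0|[k Ak fk]] := fA x.
      by apply: (@le_trans _ _ 0%E); rewrite ?lee_fin//; exact: nneseries_ge0.
    rewrite (@nneseriesD1 _ _ k)//.
    rewrite indicE mem_set//= mulr1; apply: (@le_trans _ _ (c k)%:E).
      by rewrite lee_fin.
    by rewrite leeDl//; exact: nneseries_ge0.
rewrite integral_nneseries//.
apply: le_lt_trans (nneseries_geometric_lty C0 q01).
apply: lee_nneseries => k _; first by rewrite integral_ge0.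
under eq_integral do rewrite EFinM.
rewrite ge0_integralZl//; last 2 first.
- by apply/measurable_EFinP; exact: measurable_indic.
- by rewrite lee_fin.
rewrite integral_indic// setIT.
apply: (@le_trans _ _ ((c k)%:E * (v k)%:E)%E).
  by apply: lee_wpmul2l; rewrite ?lee_fin.
by rewrite -EFinM lee_fin.
Qed.

End dyadic_domination.

Section kernel.
Context {R : realType} {n : nat}.
Local Notation E := 'rV[R]_n.+1.
Local Notation mu := (leb R n).
Local Notation d := (n.+1%:R : R).
Variable s : R.
Hypothesis s01 : 0 < s < 1.

(** A Lipschitz bounded function moves by at most a multiple of min(|z|, 1)
    under a translation by z, and the kernel of the fractional gradient is at
    most |z|^-(d+s). The norm is the maximum norm: balls are then cubes. *)
Definition kern (z : E) : R := Num.min `|z| 1 * `|z| `^ (- (d + s)).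

Lemma kern_ge0 z : 0 <= kern z.
Proof. by rewrite mulr_ge0 ?powR_ge0// le_min normr_ge0/=. Qed.

Lemma measurable_kern : measurable_fun setT (kern : lebRd R n -> R).
Proof.
apply: measurable_funM.
  exact: (measurable_minr measurable_rnorm (measurable_cst _)).
by apply: (measurableT_comp (measurable_powR _)); exact: measurable_rnorm.
Qed.

Let powR_exp (a r : R) k : 0 <= a -> (a ^+ k) `^ r = (a `^ r) ^+ k.
Proof.
by move=> a0; rewrite -(powR_mulrn k a0) -(powR_mulrn k (powR_ge0 a r)) -!powRrM mulrC.
Qed.

Let powRN_le (t x r : R) : 0 < t -> 0 <= r -> t <= x -> x `^ (- r) <= (t `^ r)^-1.
Proof.
move=> t0 r0 tx; rewrite powRN lef_pV2 ?posrE ?powR_gt0 ?(lt_le_trans t0)//.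
by apply: ge0_ler_powR => //; rewrite nnegrE ltW// (lt_le_trans t0).
Qed.

Let s_gt0 : 0 < s. Proof. by case/andP: s01. Qed.
Let s_lt1 : s < 1. Proof. by case/andP: s01. Qed.
Let d_ge1 : 1 <= d. Proof. by rewrite ler1n. Qed.
Local Notation h := (2^-1 : R).
Let h_gt0 : 0 < h. Proof. by rewrite invr_gt0. Qed.

(** Near 0 the majorant is |z|^(1-d-s), which is controlled on the shell
    2^-(k+1) <= |z| < 2^-k. *)
Lemma kern_inner (z : E) : `|z| < 1 -> kern z <= 0 \/
  exists2 k, `|z| < h ^+ k & kern z <= ((h `^ (d + s - 1))^-1) ^+ k.+1.
Proof.
move=> z1; have [->|z0] := eqVneq z 0.
  by left; rewrite /kern normr0 min_l// mul0r.
have nz0 : 0 < `|z| by rewrite normr_gt0.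
right.
have ex : exists k, h ^+ k.+1 <= `|z|.
  have [k _ /(_ k (leqnn k))/= H] := near_infty_natSinv_expn_lt (PosNum nz0).
  exists k; apply: ltW; apply: le_lt_trans H.
  rewrite div1r -exprVn ler_wiXn2l ?invr_ge0// ?invf_le1// ?ler1n//.
case: (ex_minnP ex) => k kz kmin.
exists k.
  case: k kz kmin => [|k] kz kmin; first by rewrite expr0.
  by rewrite ltNge; apply/negP => /kmin; rewrite ltnn.
rewrite /kern (min_l (ltW z1)).
have -> : `|z| * `|z| `^ (- (d + s)) = `|z| `^ (- (d + s - 1)).
  rewrite -{1}(powRr1 (normr_ge0 z)) -powRD; last by rewrite (gt_eqF nz0) implybT.
  by congr (_ `^ _); ring.
rewrite exprVn -powR_exp; last exact: ltW.
apply: powRN_le => //.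
by move: d_ge1 s_gt0; lra.
Qed.

(** Far from 0 the majorant is |z|^-(d+s), which is controlled on the shell
    2^k <= |z| < 2^(k+1). *)
Lemma kern_outer (z : E) : 1 <= `|z| ->
  exists2 k, `|z| < 2 ^+ k.+1 & kern z <= ((2 `^ (d + s))^-1) ^+ k.
Proof.
move=> z1.
have ex : exists k, `|z| < 2 ^+ k.+1.
  exists (Num.truncn `|z|); apply: lt_le_trans (truncnS_gt _) _.
  by rewrite -natrX ler_nat ltnW// ltn_expl.
case: (ex_minnP ex) => k kz kmin.
exists k => //.
rewrite /kern min_r// mul1r exprVn -powR_exp//.
apply: powRN_le; [by rewrite exprn_gt0|by move: d_ge1 s_gt0; lra|].
case: k kz kmin => [|k] kz kmin; first by rewrite expr0.
by rewrite leNgt; apply/negP => /kmin; rewrite ltnn.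
Qed.

(** The shell of radius 2^-k contributes a multiple of 2^-(k(1-s)), where s < 1
    matters, and the shell of radius 2^k a multiple of 2^-(ks), where s > 0
    matters. *)
Lemma integral_kern_lty : (\int[mu]_z (kern z)%:E < +oo)%E.
Proof.
pose B : set (lebRd R n) := [set z : E | `|z| < 1].
have mB : measurable B by exact: measurable_rball.
have mk1 : measurable_fun setT (fun z : lebRd R n => kern z * \1_B z).
  by apply: measurable_funM; [exact: measurable_kern|exact: measurable_indic].
have mk2 : measurable_fun setT (fun z : lebRd R n => kern z * \1_(~` B) z).
  apply: measurable_funM; first exact: measurable_kern.
  by apply: measurable_indic; exact: measurableC.
have k10 z : 0 <= kern z * \1_B z by rewrite mulr_ge0// kern_ge0.
have k20 z : 0 <= kern z * \1_(~` B) z by rewrite mulr_ge0// kern_ge0.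
have p1 r : 1 `^ r = 1 :> R by rewrite powR1.
have i1 : (\int[mu]_z (kern z * \1_B z)%:E < +oo)%E.
  apply: (@integral_lty_geometric _ _ _ mu _
    (fun k => [set z : E | `|z| < h ^+ k])
    (fun k => ((h `^ (d + s - 1))^-1) ^+ k.+1)
    (fun k => (2 * h ^+ k) ^+ n.+1)
    ((h `^ (d + s - 1))^-1 * 2 ^+ n.+1) (h `^ (1 - s)) mk1 k10).
  - by move=> k; exact: measurable_rball.
  - by move=> k; rewrite exprn_ge0// invr_ge0 powR_ge0.
  - by move=> k; apply: leb_rball_le; rewrite exprn_ge0// ltW.
  - move=> z; have [z1|z1] := ltP `|z| 1.
      rewrite indicE mem_set// mulr1; exact: kern_inner.
    by left; rewrite indicE memNset ?mulr0// /B/= ltNge z1.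
  - by rewrite mulr_ge0// ?invr_ge0 ?powR_ge0 ?exprn_ge0.
  - rewrite powR_ge0/= -[ltRHS](p1 (1 - s)).
    by apply: gt0_ltr_powR; rewrite ?nnegrE ?(ltW h_gt0) ?invf_lt1 ?ltr1n// subr_gt0.
  - move=> k; rewrite exprMn exprS.
    have -> : h `^ (1 - s) = h ^+ n.+1 / h `^ (d + s - 1).
      rewrite -powR_mulrn ?(ltW h_gt0)// -powRB; last by rewrite (gt_eqF h_gt0) implybT.
      by congr (_ `^ _); ring.
    rewrite exprMn -!exprM (mulnC n.+1).
    by rewrite le_eqVlt; apply/orP; left; apply/eqP; ring.
have i2 : (\int[mu]_z (kern z * \1_(~` B) z)%:E < +oo)%E.
  apply: (@integral_lty_geometric _ _ _ mu _
    (fun k => [set z : E | `|z| < 2 ^+ k.+1])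
    (fun k => ((2 `^ (d + s))^-1) ^+ k)
    (fun k => (2 * 2 ^+ k.+1) ^+ n.+1)
    (4 ^+ n.+1) (2 `^ (- s)) mk2 k20).
  - by move=> k; exact: measurable_rball.
  - by move=> k; rewrite exprn_ge0// invr_ge0 powR_ge0.
  - by move=> k; apply: leb_rball_le; rewrite exprn_ge0.
  - move=> z; have [z1|z1] := ltP `|z| 1.
      by left; rewrite indicE memNset ?mulr0// /B/=; apply.
    right; rewrite indicE mem_set ?mulr1; first exact: kern_outer.
    by rewrite /B/= => /(le_lt_trans z1); rewrite ltxx.
  - by rewrite exprn_ge0.
  - rewrite powR_ge0/= powRN invf_lt1 ?powR_gt0// -[ltLHS](p1 s).
    by apply: gt0_ltr_powR; rewrite ?nnegrE ?ltr1n.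
  - move=> k.
    have -> : 2 `^ (- s) = 2 ^+ n.+1 / 2 `^ (d + s) :> R.
      rewrite -powR_mulrn// -powRB; last by rewrite pnatr_eq0 implybT.
      by congr (_ `^ _); ring.
    have -> : 2 * 2 ^+ k.+1 = 4 * 2 ^+ k :> R by rewrite exprS; ring.
    rewrite !exprMn -!exprM (mulnC n.+1).
    by rewrite le_eqVlt; apply/orP; left; apply/eqP; ring.
have kE z : kern z = kern z * \1_B z + kern z * \1_(~` B) z.
  by rewrite -mulrDr !indicE in_setC; case: (z \in B); rewrite ?addr0 ?add0r mulr1.
under eq_integral do rewrite kE EFinD.
rewrite ge0_integralD.
- exact: lte_add_pinfty.
- exact: measurableT.
- by move=> z _; rewrite lee_fin k10.
- exact/measurable_EFinP.
- by move=> z _; rewrite lee_fin k20.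
- exact/measurable_EFinP.
Qed.

End kernel.

(** * Integrability, L^p membership and Fubini *)

Section integrability_tools.
Context d (T : measurableType d) (R : realType) (m : {measure set T -> \bar R}).

Lemma dominated_integrable_EFin (f g : T -> R) :
  measurable_fun setT f -> (forall x, `|f x| <= g x) ->
  m.-integrable setT (EFin \o g) -> m.-integrable setT (EFin \o f).
Proof.
move=> mf fg; apply: le_integrable => //; first exact/measurable_EFinP.
by move=> x _ /=; rewrite lee_fin (le_trans (fg x))// ler_norm.
Qed.

Lemma integrable_EFin_lty (f : T -> R) :
  measurable_fun setT f -> (\int[m]_x (`|f x|)%:E < +oo)%E ->
  m.-integrable setT (EFin \o f).
Proof. by move=> mf fi; apply/integrableP; split => //; exact/measurable_EFinP. Qed.

Lemma mul_bounded_integrable (f g : T -> R) (M : R) :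
  m.-integrable setT (EFin \o f) -> measurable_fun setT g ->
  (forall x, `|g x| <= M) -> m.-integrable setT (EFin \o (fun x => f x * g x)).
Proof.
move=> fi mg gM.
have mf : measurable_fun setT f by apply/measurable_EFinP; exact: measurable_int fi.
apply: (@dominated_integrable_EFin _ (fun x => M * `|f x|)).
- exact: measurable_funM.
- by move=> x; rewrite normrM mulrC ler_wpM2r.
- exact: (integrableZl measurableT M (integrable_norm fi)).
Qed.

Lemma Rintegral_EFin (f : T -> R) : m.-integrable setT (EFin \o f) ->
  (\int[m]_x f x)%R%:E = (\int[m]_x (f x)%:E)%E.
Proof. by move=> fi; rewrite /Rintegral fineK//; exact: integrable_fin_num. Qed.

Lemma Lfun_measurable (f : T -> R) p : f \in Lfun m p -> measurable_fun setT f.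
Proof. by case/andP; rewrite inE. Qed.

Lemma Lfun_powR_integrable (f : T -> R) (r : R) : r != 0 ->
  measurable_fun setT f ->
  m.-integrable setT (fun x => (`|f x| `^ r)%:E) -> f \in Lfun m r%:E.
Proof.
move=> r0 mf /integrableP[_ fi]; apply/andP; split; rewrite inE//=.
rewrite /finite_norm unlock; apply: poweR_lty.
apply: le_lt_trans fi; rewrite le_eqVlt; apply/orP; left; apply/eqP.
by apply: eq_integral => x _ /=; rewrite [in RHS]ger0_norm ?powR_ge0.
Qed.

(** |f|^r <= M^(r-1) |f|. *)
Lemma bounded_integrable_Lfun (f : T -> R) (M r : R) : 1 <= r ->
  (forall x, `|f x| <= M) -> m.-integrable setT (EFin \o f) ->
  f \in Lfun m r%:E.
Proof.
move=> r1 fM fi; have mf : measurable_fun setT f.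
  by apply/measurable_EFinP; exact: measurable_int fi.
apply: Lfun_powR_integrable => //; first by rewrite gt_eqF// (lt_le_trans ltr01).
have Mf : m.-integrable setT (EFin \o (fun x => M `^ (r - 1) * `|f x|)).
  have := integrableZl measurableT (M `^ (r - 1)) (integrable_norm fi).
  by apply: eq_integrable => // x _ /=; rewrite EFinM.
apply: dominated_integrable_EFin Mf.
  by apply: (measurableT_comp (measurable_powR _)); exact: measurableT_comp.
move=> x; rewrite ger0_norm ?powR_ge0//.
rewrite -(@mulr_powRB1 _ `|f x|) ?(lt_le_trans ltr01)// mulrC ler_wpM2r//.
by apply: ge0_ler_powR; rewrite ?subr_ge0// nnegrE// (le_trans _ (fM x)).
Qed.

End integrability_tools.

Section product_swap.
Context d (T : measurableType d) (R : realType).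
Variable m : {sigma_finite_measure set T -> \bar R}.
Local Notation m2 := (m \x m)%E.

Lemma integrable_prod_swap (F : T -> T -> R) :
  m2.-integrable setT (fun w => (F w.1 w.2)%:E) ->
  m2.-integrable setT (fun w => (F w.2 w.1)%:E).
Proof.
move=> Fi; have mF := measurable_int _ Fi.
apply/(integrable21ltyP m m).
  exact: (measurableT_comp mF (@measurable_swap _ _ T T)).
by have /(integrable12ltyP m m mF) := Fi.
Qed.

(** Fubini's theorem with the two variables renamed. *)
Lemma integral_prod_swap (F : T -> T -> R) :
  m2.-integrable setT (fun w => (F w.1 w.2)%:E) ->
  (\int[m2]_w (F w.2 w.1)%:E = \int[m2]_w (F w.1 w.2)%:E)%E.
Proof.
move=> Fi; rewrite -(integral21_prod_meas1 (integrable_prod_swap Fi)).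
by rewrite -(integral12_prod_meas1 Fi).
Qed.

End product_swap.

(** * The kernel and Lipschitz functions with bounded support *)

Section euclidean_norm.
Context {R : realType} {n : nat}.
Local Notation E := 'rV[R]_n.+1.
Implicit Types x y z : E.

Lemma dotv_ge0 x : 0 <= dotv x x.
Proof. by apply: sumr_ge0 => i _; rewrite -expr2 sqr_ge0. Qed.

Lemma enorm_ge0 x : 0 <= enorm x.
Proof. exact: sqrtr_ge0. Qed.

Lemma enormN x : enorm (- x) = enorm x.
Proof. by congr Num.sqrt; apply: eq_bigr => i _; rewrite mxE mulrNN. Qed.

Lemma coord_le_enorm x i : `|x 0 i| <= enorm x.
Proof.
rewrite -sqrtr_sqr ler_sqrt ?dotv_ge0// /dotv (bigD1 i)//= expr2 lerDl.
by apply: sumr_ge0 => j _; rewrite -expr2 sqr_ge0.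
Qed.

Lemma rnorm_le_enorm x : `|x| <= enorm x.
Proof. by apply: le_rnorm => [|i]; [exact: enorm_ge0|exact: coord_le_enorm]. Qed.

Lemma enorm_le_sum x : enorm x <= \sum_i `|x 0 i|.
Proof.
have s0 : 0 <= \sum_i `|x 0 i| by exact: sumr_ge0.
rewrite -(ger0_norm s0) -sqrtr_sqr ler_sqrt ?sqr_ge0// expr2 mulr_suml.
apply: ler_sum => i _; rewrite -expr2 -real_normK ?num_real// expr2.
by rewrite ler_wpM2l// (bigD1 i)//= lerDl sumr_ge0.
Qed.

Lemma dotv_le x y : `|dotv x y| <= enorm x * \sum_i `|y 0 i|.
Proof.
rewrite mulr_sumr (le_trans (ler_norm_sum _ _ _))//.
by apply: ler_sum => i _; rewrite normrM ler_wpM2r// coord_le_enorm.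
Qed.

End euclidean_norm.

Section kernel_kappa.
Context {R : realType} {n : nat}.
Local Notation E := 'rV[R]_n.+1.
Local Notation mu := (leb R n).
Local Notation T := (lebRd R n).
Local Notation d := (n.+1%:R : R).
Variable s : R.
Hypothesis s01 : 0 < s < 1.

(** The vector kernel of the fractional gradient, as a function of z = y - x:
    its i-th component is (x - y)_i / |x - y|^(d+s+1) with Euclidean norms. *)
Definition kappa (i : 'I_n.+1) (z : E) : R :=
  (enorm z `^ (d + s))^-1 * (- z 0 i / enorm z).

Lemma kappaN i z : kappa i (- z) = - kappa i z.
Proof. by rewrite /kappa enormN mxE opprK mulNr mulrN opprK. Qed.

Lemma measurable_kappa d' (X : measurableType d') i (v : X -> E) :
  (forall j, measurable_fun setT (fun x => v x 0 j)) ->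
  measurable_fun setT (fun x => kappa i (v x)).
Proof.
move=> mv.
have me : measurable_fun setT (fun x => enorm (v x)).
  rewrite (_ : (fun x => _) = fun x => (dotv (v x) (v x)) `^ 2^-1); last first.
    by apply/funext => x; rewrite powR12_sqrt// dotv_ge0.
  apply: (measurableT_comp (measurable_powR _)).
  by apply: measurable_sum => j; apply: measurable_funM.
rewrite (_ : (fun x => _) = fun x =>
    enorm (v x) `^ (- (d + s)) * (- v x 0 i * enorm (v x) `^ (- 1))); last first.
  by apply/funext => x; rewrite /kappa powRN powR_inv1// enorm_ge0.
apply: measurable_funM; first exact: (measurableT_comp (measurable_powR _)).
apply: measurable_funM; last exact: (measurableT_comp (measurable_powR _)).
exact: measurableT_comp.
Qed.

Lemma kappa_le_kern i z : Num.min `|z| 1 * `|kappa i z| <= kern s z.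
Proof.
apply: ler_wpM2l; first by rewrite le_min normr_ge0 ler01.
have [->|z0] := eqVneq z 0.
  by rewrite /kappa mxE oppr0 mul0r mulr0 !normr0 powR_ge0.
have nz0 : 0 < `|z| by rewrite normr_gt0.
have ez0 : 0 < enorm z := lt_le_trans nz0 (rnorm_le_enorm z).
have [s0 s1] := andP s01.
have ds : 0 <= d + s by rewrite addr_ge0// ltW.
rewrite /kappa normrM normfV (ger0_norm (powR_ge0 _ _)) powRN.
rewrite -[leRHS]mulr1 ler_pM ?invr_ge0 ?powR_ge0//.
- rewrite lef_pV2 ?posrE ?powR_gt0//; apply: ge0_ler_powR => //.
  + by rewrite nnegrE ltW.
  + by rewrite nnegrE enorm_ge0.
  + exact: rnorm_le_enorm.
- by rewrite normrM normrN normfV (gtr0_norm ez0) ler_pdivrMr// mul1r coord_le_enorm.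
Qed.

End kernel_kappa.

Section lipschitz_compactly_supported.
Context {R : realType} {n : nat}.
Local Notation E := 'rV[R]_n.+1.
Local Notation mu := (leb R n).
Local Notation T := (lebRd R n).

(** The properties of test functions on which the fractional gradient depends. A
    single constant for the Lipschitz bound, the values and the support keeps the
    estimates short. *)
Definition lip_csupp (phi : E -> R) (K : R) :=
  [/\ forall x y, `|phi x - phi y| <= K * `|y - x|,
      forall x, `|phi x| <= K & forall x, phi x != 0 -> `|x| < K].

Lemma lip_csupp_ge0 phi K : lip_csupp phi K -> 0 <= K.
Proof. by move=> [_ /(_ 0) + _]; exact: le_trans. Qed.

Lemma lip_csupp_continuous phi K : lip_csupp phi K -> continuous phi.
Proof.
move=> phiK; have K0 := lip_csupp_ge0 phiK; have [L _ _] := phiK.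
move=> x; have F : Filter (nbhs x) by exact: nbhs_filter.
apply/cvgrPdist_lt => e e0.
have K1 : 0 < K + 1 by rewrite ltr_wpDl.
have := nbhsx_ballx x (e / (K + 1)) (divr_gt0 e0 K1).
apply: filterS => y; rewrite -ball_normE /ball_/= => xy.
apply: (le_lt_trans (L _ _)).
apply: (@le_lt_trans _ _ ((K + 1) * `|y - x|)); first by rewrite ler_wpM2r// lerDl.
by rewrite mulrC -ltr_pdivlMr// distrC.
Qed.

Lemma lip_csupp_measurable phi K : lip_csupp phi K -> measurable_fun setT (phi : T -> R).
Proof. by move=> /lip_csupp_continuous; exact: continuous_measurable_leb. Qed.

Lemma lip_csuppM phi psi K1 K2 : lip_csupp phi K1 -> lip_csupp psi K2 ->
  lip_csupp (phi \* psi) (2 * K1 * K2 + K1).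
Proof.
move=> phiK psiK; have K10 := lip_csupp_ge0 phiK; have K20 := lip_csupp_ge0 psiK.
have [L1 B1 S1] := phiK; have [L2 B2 S2] := psiK.
split => [x y|x|x] /=.
- have -> : phi x * psi x - phi y * psi y =
      (phi x - phi y) * psi x + phi y * (psi x - psi y) by ring.
  rewrite (le_trans (ler_normD _ _))// !normrM.
  apply: (@le_trans _ _ (K1 * `|y - x| * K2 + K1 * (K2 * `|y - x|))).
    by rewrite lerD// ler_pM.
  have -> : K1 * `|y - x| * K2 + K1 * (K2 * `|y - x|) = 2 * K1 * K2 * `|y - x|.
    by ring.
  by rewrite ler_wpM2r// lerDl.
- rewrite normrM; apply: (@le_trans _ _ (K1 * K2)); first by rewrite ler_pM.
  by have := mulr_ge0 K10 K20; lra.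
- rewrite mulf_eq0 negb_or => /andP[/S1 x1 _].
  by have := mulr_ge0 K10 K20; lra.
Qed.

Lemma lip_csupp_le_indic phi K x : lip_csupp phi K ->
  `|phi x| <= K * \1_[set y : E | `|y| < K] x.
Proof.
move=> [_ B S]; have [->|/S xK] := eqVneq (phi x) 0.
  by rewrite normr0 mulr_ge0// (le_trans _ (B 0)).
by rewrite indicE mem_set// mulr1.
Qed.

Lemma lip_csupp_integrable phi K : lip_csupp phi K ->
  mu.-integrable setT (EFin \o phi : T -> \bar R).
Proof.
move=> phiK; pose B : set T := [set y : E | `|y| < K].
have mB : measurable B by exact: measurable_rball.
have iB : mu.-integrable setT (fun x => (\1_B x)%:E).
  apply: integrable_EFin_lty; first exact: measurable_indic.
  under eq_integral do rewrite ger0_norm//.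
  by rewrite integral_indic//= setIT; exact: leb_rball_lty.
apply: (@dominated_integrable_EFin _ _ _ mu phi (fun x => K * \1_B x)).
- exact: lip_csupp_measurable phiK.
- by move=> x; exact: lip_csupp_le_indic.
- exact: (integrableZl measurableT K iB).
Qed.

Lemma lip_csupp_Lfun phi K r : 1 <= r -> lip_csupp phi K ->
  (phi : T -> R) \in Lfun mu r%:E.
Proof.
move=> r1 phiK; apply: (bounded_integrable_Lfun r1 (M := K)).
  by case: phiK.
exact: lip_csupp_integrable phiK.
Qed.

End lipschitz_compactly_supported.

(** * The fractional gradient of a test function *)

Section fractional_difference.
Context {R : realType} {n : nat}.
Local Notation E := 'rV[R]_n.+1.
Local Notation mu := (leb R n).
Local Notation T := (lebRd R n).
Local Notation m := (@leb_sf R n).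
Variable s : R.
Hypothesis s01 : 0 < s < 1.
Implicit Types (phi psi : E -> R) (K : R).

(** The integrand of the fractional gradient as a function of both points. *)
Definition fdiff i phi (x y : E) : R := (phi x - phi y) * kappa s i (y - x).

Lemma coord_fst (j : 'I_n.+1) : measurable_fun setT (fun w : T * T => w.1 0 j).
Proof. exact: (measurableT_comp (measurable_coord j) measurable_fst). Qed.

Lemma coord_snd (j : 'I_n.+1) : measurable_fun setT (fun w : T * T => w.2 0 j).
Proof. exact: (measurableT_comp (measurable_coord j) measurable_snd). Qed.

Lemma measurable_fdiff i phi : continuous phi ->
  measurable_fun setT (fun w : T * T => fdiff i phi w.1 w.2).
Proof.
move=> cphi; apply: measurable_funM.
  apply: measurable_funB.
    exact: (measurable_continuous_comp cphi coord_fst).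
  exact: (measurable_continuous_comp cphi coord_snd).
apply: measurable_kappa => j.
under eq_fun do rewrite !mxE.
apply: measurable_funD; first exact: coord_snd.
by apply: measurableT_comp => //; exact: coord_fst.
Qed.

Lemma measurable_fdiff_section i phi x : continuous phi ->
  measurable_fun setT (fdiff i phi x : T -> R).
Proof.
move=> cphi.
exact: (measurableT_comp (measurable_fdiff i cphi) (pair1_measurable (x : T))).
Qed.

(** The increment of phi from x to y is at most K min(|y - x|, 1), and vanishes
    unless x or y is in the support: this separates the integrable majorant
    in y - x from a function with support of finite measure in x or in y. *)
Lemma fdiff_le i phi K x y : lip_csupp phi K -> `|fdiff i phi x y| <=
  K * (kern s (y - x) * (\1_[set z : E | `|z| < K] x + \1_[set z : E | `|z| < K] y)).
Proof.
move=> phiK; have K0 := lip_csupp_ge0 phiK; have [L _ _] := phiK.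
set I := \1__ x + \1__ y.
have I0 : 0 <= I by rewrite addr_ge0.
rewrite normrM.
suff H : `|phi x - phi y| <= K * (Num.min `|y - x| 1 * I).
  apply: (le_trans (ler_wpM2r (normr_ge0 _) H)).
  rewrite -mulrA ler_wpM2l// mulrAC ler_wpM2r//.
  exact: kappa_le_kern.
have HI : `|phi x - phi y| <= K * I.
  rewrite mulrDr (le_trans (ler_normB _ _))//.
  by apply: lerD; exact: lip_csupp_le_indic.
have [yx|yx] := leP `|y - x| 1; last first.
  by rewrite mul1r.
have [I1|I1] := leP 1 I.
  apply: (le_trans (L _ _)); rewrite ler_wpM2l// -[leLHS]mulr1.
  by rewrite ler_wpM2l.
have I00 : I = 0.
  move: I1; rewrite /I !indicE.
  by case: (_ \in _); case: (_ \in _) => /=; rewrite ?addr0 ?add0r ?ltxx//; lra.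
by move: HI; rewrite I00 !mulr0.
Qed.

Definition kern_mass : R := \int[mu]_z kern s z.

Lemma kern_integrable : mu.-integrable setT (EFin \o (kern s : T -> R)).
Proof.
apply: integrable_EFin_lty; first exact: measurable_kern.
under eq_integral do rewrite ger0_norm ?kern_ge0//.
exact: integral_kern_lty.
Qed.

Lemma kern_massE : kern_mass%:E = (\int[mu]_z (kern s z)%:E)%E.
Proof. exact: Rintegral_EFin kern_integrable. Qed.

Lemma integral_kern_translate x : (\int[mu]_y (kern s (y - x)%R)%:E = kern_mass%:E)%E.
Proof.
rewrite kern_massE.
apply: (ge0_integral_translate (- x) (f := EFin \o kern s)).
- by apply/measurable_EFinP; exact: measurable_kern.
- by move=> y; rewrite lee_fin kern_ge0.
Qed.

Lemma measurable_kern_sub : measurable_fun setT (fun w : T * T => kern s (w.2 - w.1)).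
Proof.
have mn : measurable_fun setT (fun w : T * T => `|(w.2 - w.1 : E)|).
  apply: (measurable_continuous_comp (g := fun x : E => `|x|)).
    by move=> x; exact: norm_continuous.
  move=> j; under eq_fun do rewrite !mxE.
  apply: measurable_funD; first exact: coord_snd.
  by apply: measurableT_comp => //; exact: coord_fst.
apply: measurable_funM; first exact: (measurable_minr mn (measurable_cst _)).
exact: (measurableT_comp (measurable_powR _) mn).
Qed.

(** By Tonelli the integral is the measure of the ball times the integral of
    the majorant. *)
Lemma kern_indic_ball_integrable K : (m \x m)%E.-integrable setT
  (fun w : T * T => (kern s (w.2 - w.1) * \1_[set z : E | (`|z| < K)%R] w.1)%:E).
Proof.
pose B : set T := [set z : E | `|z| < K].
have mB : measurable B by exact: measurable_rball.
apply/(integrable12ltyP m m).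
  apply/measurable_EFinP; apply: measurable_funM; first exact: measurable_kern_sub.
  apply: (measurableT_comp _ measurable_fst); exact: measurable_indic.
suff H : (\int[mu]_x \int[mu]_y
    `|(kern s (y - x)%R * \1_B x)%:E| < +oo)%E by exact: H.
have Hx x : (\int[mu]_y `|(kern s (y - x)%R * \1_B x)%:E| =
    kern_mass%:E * (\1_B x)%:E)%E.
  rewrite -(integral_kern_translate x) -ge0_integralZr.
  - apply: (@eq_integral _ T R mu setT) => y _.
    by rewrite -EFinM abse_EFin ger0_norm// mulr_ge0// kern_ge0.
  - exact: measurableT.
  - apply/measurable_EFinP.
    exact: (measurableT_comp measurable_kern_sub (pair1_measurable (x : T))).
  - by move=> y _; rewrite lee_fin kern_ge0.
  - by rewrite lee_fin.
have M0 : 0 <= kern_mass by apply: Rintegral_ge0 => z _; exact: kern_ge0.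
rewrite (eq_integral (fun x => kern_mass%:E * (\1_B x)%:E)%E); last first.
  by move=> x _; exact: Hx.
rewrite ge0_integralZl.
- rewrite integral_indic; [|exact: measurableT|exact: mB].
  rewrite setIT lte_mul_pinfty//; exact: leb_rball_lty.
- exact: measurableT.
- by apply/measurable_EFinP; exact: measurable_indic.
- by move=> x _; rewrite lee_fin.
- by rewrite lee_fin.
Qed.

(** Absolute integrability on the product is what Fubini requires; the
    singularity of the kernel is compensated by the increment of phi. *)
Lemma fdiff_integrable i phi K : lip_csupp phi K ->
  (m \x m)%E.-integrable setT (fun w : T * T => (fdiff i phi w.1 w.2)%:E).
Proof.
move=> phiK; have H := kern_indic_ball_integrable K.
have H' := integrable_prod_swap
  (F := fun x y : T => kern s (y - x) * \1_[set z : E | `|z| < K] x) H.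
apply: (@dominated_integrable_EFin _ _ _ (m \x m)%E _
  (fun w : T * T => K * (kern s (w.2 - w.1) * \1_[set z : E | `|z| < K] w.1 +
    kern s (w.1 - w.2) * \1_[set z : E | `|z| < K] w.2))).
- exact: measurable_fdiff (lip_csupp_continuous phiK).
- move=> w.
  have G (f k c e : R) : f <= K * (k * (c + e)) -> f <= K * (k * c + k * e).
    by rewrite mulrDr.
  have -> : kern s (w.1 - w.2) = kern s (w.2 - w.1) by rewrite /kern distrC.
  exact: G (fdiff_le _ _ _ phiK).
- exact: (integrableZl measurableT K (integrableD measurableT H H')).
Qed.

Lemma fdiff_section_le i phi K x y : lip_csupp phi K ->
  `|fdiff i phi x y| <= 2 * K * kern s (y - x).
Proof.
move=> phiK; have K0 := lip_csupp_ge0 phiK; apply: (le_trans (fdiff_le _ _ _ phiK)).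
have G (k c : R) : 0 <= k -> c <= 2 -> K * (k * c) <= 2 * K * k.
  move=> k0 c2; have -> : 2 * K * k = K * (k * 2) by ring.
  by rewrite !ler_wpM2l.
by apply: G; rewrite ?kern_ge0// !indicE; case: (_ \in _); case: (_ \in _) => /=; lra.
Qed.

Lemma kern_translate_integrable x (c : R) :
  mu.-integrable setT (EFin \o (fun y : T => c * kern s (y - x))).
Proof.
exact: (integrableZl measurableT c (integrable_translate (- x) kern_integrable)).
Qed.

Lemma fdiff_section_integrable i phi K x : lip_csupp phi K ->
  mu.-integrable setT (EFin \o (fdiff i phi x : T -> R)).
Proof.
move=> phiK.
apply: (dominated_integrable_EFin (g := fun y : T => 2 * K * kern s (y - x))).
- exact: measurable_fdiff_section (lip_csupp_continuous phiK).
- by move=> y; exact: fdiff_section_le.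
- exact: kern_translate_integrable.
Qed.

(** The i-th component of the fractional gradient up to its constant. *)
Definition fgrad i phi (x : E) : R := \int[mu]_y fdiff i phi x y.

Lemma fgrad_EFin i phi K x : lip_csupp phi K ->
  (fgrad i phi x)%:E = (\int[mu]_y (fdiff i phi x y)%:E)%E.
Proof. by move=> phiK; exact: Rintegral_EFin (fdiff_section_integrable i x phiK). Qed.

Lemma frac_gradE i phi x :
  frac_grad s phi x 0 i = frac_const (n := n) s * fgrad i phi x.
Proof.
rewrite /frac_grad mxE; congr (_ * _); apply: eq_Rintegral => y _.
rewrite /fdiff /kappa -(opprB x y) enormN [in RHS]mxE opprK.
by rewrite -!mulrA.
Qed.

Lemma fgrad_le i phi K x : lip_csupp phi K -> `|fgrad i phi x| <= 2 * K * kern_mass.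
Proof.
move=> phiK; have fi := fdiff_section_integrable i x phiK.
apply: (le_trans (le_normr_Rintegral measurableT fi)).
have -> : 2 * K * kern_mass = \int[mu]_y (2 * K * kern s (y - x)).
  rewrite RintegralZl; [|exact: measurableT|].
    exact: (congr1 (fun c => 2 * K * c) (esym (congr1 fine (integral_kern_translate x)))).
  exact: (integrable_translate (- x) kern_integrable).
apply: (le_Rintegral measurableT (integrable_norm fi) (kern_translate_integrable x _)).
by move=> y _; exact: fdiff_section_le.
Qed.

Lemma fgrad_integrable i phi K : lip_csupp phi K ->
  mu.-integrable setT (EFin \o (fgrad i phi : T -> R)).
Proof.
move=> phiK; have := integrable_fubini_F (fdiff_integrable i phiK).
by apply: eq_integrable; [exact: measurableT | move=> x _; rewrite /= (fgrad_EFin i x phiK)].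
Qed.

(** The fractional gradient is both bounded and integrable. *)
Lemma fgrad_Lfun i phi K r : 1 <= r -> lip_csupp phi K ->
  (fgrad i phi : T -> R) \in Lfun mu r%:E.
Proof.
move=> r1 phiK; apply: (bounded_integrable_Lfun r1 (M := 2 * K * kern_mass)).
  by move=> x; exact: fgrad_le.
exact: fgrad_integrable phiK.
Qed.

End fractional_difference.

(** * Fractional integration by parts *)

Section fractional_integration_by_parts.
Context {R : realType} {n : nat}.
Local Notation E := 'rV[R]_n.+1.
Local Notation mu := (leb R n).
Local Notation T := (lebRd R n).
Local Notation m := (@leb_sf R n).
Local Notation m2 := (m \x m)%E.
Variable s : R.
Hypothesis s01 : 0 < s < 1.
Implicit Types (phi psi : E -> R) (K : R).

(** With y = z + x the double integral is that of (phi(x) - phi(z + x)) kappa(z).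
    Integrating in x first gives 0, since phi and its translates have the same
    integral. *)
Lemma fdiff_mass_eq0 i phi K : lip_csupp phi K ->
  (\int[m2]_w (fdiff s i phi w.1 w.2)%:E = 0)%E.
Proof.
move=> phiK; have cphi := lip_csupp_continuous phiK.
have Ai := fdiff_integrable s01 i phiK.
pose C (x z : E) := (phi x - phi (z + x)) * kappa s i z.
have Cz x z : C x z = fdiff s i phi x (z + x) by rewrite /C /fdiff addrK.
have mC : measurable_fun setT (fun w : T * T => (C w.1 w.2)%:E).
  apply/measurable_EFinP; apply: measurable_funM.
    apply: measurable_funB.
      exact: (measurable_continuous_comp cphi coord_fst).
    apply: (measurable_continuous_comp cphi) => j.
    under eq_fun do rewrite !mxE.
    apply: measurable_funD; [exact: coord_snd | exact: coord_fst].
  exact: measurable_kappa coord_snd.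
have mA x : measurable_fun setT (fun y : T => (fdiff s i phi x y)%:E).
  by apply/measurable_EFinP; exact: measurable_fdiff_section.
have Ci : m2.-integrable setT (fun w : T * T => (C w.1 w.2)%:E).
  apply/(integrable12ltyP m m mC).
  have /(integrable12ltyP m m (measurable_int _ Ai)) := Ai.
  apply: le_lt_trans; rewrite le_eqVlt; apply/orP; left; apply/eqP.
  apply: (@eq_integral _ T R mu setT) => x _.
  have mAx : measurable_fun setT (fun y : T => `|(fdiff s i phi x y)%:E|%E).
    by apply: measurableT_comp => //; exact: mA.
  have := ge0_integral_translate x mAx (fun y => abse_ge0 _).
  by under eq_integral do rewrite -Cz.
transitivity (\int[mu]_x \int[mu]_y (fdiff s i phi x y)%:E)%E.
  exact: (esym (integral12_prod_meas1 Ai)).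
transitivity (\int[mu]_x \int[mu]_z (C x z)%:E)%E.
  apply: (@eq_integral _ T R mu setT) => x _.
  have := integral_translate x (mA x).
  by under eq_integral do rewrite -Cz.
transitivity (\int[mu]_z \int[mu]_x (C x z)%:E)%E.
  exact: (Fubini Ci).
apply: integral0_eq => z _.
have phii := lip_csupp_integrable phiK.
have phizi := integrable_translate z phii.
have zphii : mu.-integrable setT (EFin \o (fun x : T => phi (z + x))).
  by apply: eq_integrable phizi => [|x _] /=; [exact: measurableT|rewrite addrC].
have -> : (\int[mu]_x (C x z)%:E =
    \int[mu]_x ((EFin \o (fun x => phi x - phi (z + x))%R) x * (kappa s i z)%:E))%E.
  by [].
rewrite integralZr; [|exact: measurableT|exact: (integrableB measurableT phii zphii)].
rewrite integralB_EFin; [|exact: measurableT|exact: phii|exact: zphii].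
have -> : (\int[mu]_x (phi (z + x)%R)%:E = \int[mu]_x (phi x)%:E)%E.
  rewrite -[RHS](integral_translate z (measurable_int _ phii)).
  by apply: (@eq_integral _ T R mu setT) => x _; rewrite /= addrC.
rewrite subee ?mul0e//; exact: (integrable_fin_num measurableT phii).
Qed.

Lemma mul_fdiff_integrable i phi psi K1 K2 : lip_csupp phi K1 -> lip_csupp psi K2 ->
  m2.-integrable setT (fun w : T * T => (psi w.1 * fdiff s i phi w.1 w.2)%:E).
Proof.
move=> phiK psiK; have K20 := lip_csupp_ge0 psiK.
have Ai := integrable_norm (fdiff_integrable s01 i phiK).
apply: (dominated_integrable_EFin
  (g := fun w : T * T => K2 * `|fdiff s i phi w.1 w.2|)).
- apply: measurable_funM.
    exact: (measurableT_comp (lip_csupp_measurable psiK) measurable_fst).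
  exact: measurable_fdiff (lip_csupp_continuous phiK).
- by move=> w; rewrite normrM ler_wpM2r//; case: psiK.
- exact: (integrableZl measurableT K2 Ai).
Qed.

Lemma integral_mul_fgrad i phi psi K1 K2 : lip_csupp phi K1 -> lip_csupp psi K2 ->
  (\int[mu]_x (psi x * fgrad s i phi x)%:E =
   \int[m2]_w (psi w.1 * fdiff s i phi w.1 w.2)%:E)%E.
Proof.
move=> phiK psiK.
transitivity (\int[mu]_x \int[mu]_y (psi x * fdiff s i phi x y)%:E)%E; last first.
  exact: (integral12_prod_meas1 (mul_fdiff_integrable i phiK psiK)).
apply: (@eq_integral _ T R mu setT) => x _.
rewrite EFinM (fgrad_EFin s01 i x phiK) -integralZl.
- by [].
- exact: measurableT.
- exact: fdiff_section_integrable phiK.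
Qed.

(** Let P and Q be the integrands, in x and y, of the two integrals. Exchanging
    x and y does not change an integral over the product, and as kappa is odd the
    identity
    (phi(x) - phi(y)) (psi(x) + psi(y)) + (psi(x) - psi(y)) (phi(x) + phi(y))
    = 2 (phi(x) psi(x) - phi(y) psi(y))
    shows that P, Q and their exchanges add up to twice the integrand for the
    product phi psi, whose integral is 0. Only differences are multiplied by the
    kernel, so that no principal value occurs. *)
Lemma fgrad_antisymmetric i phi psi K1 K2 : lip_csupp phi K1 -> lip_csupp psi K2 ->
  \int[mu]_x (fgrad s i phi x * psi x) = - \int[mu]_x (phi x * fgrad s i psi x).
Proof.
have halve (x y : R) : (x + x) + (y + y) = 0 -> x = - y by lra.
move=> phiK psiK.
pose P (x y : T) := psi x * fdiff s i phi x y.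
pose Q (x y : T) := phi x * fdiff s i psi x y.
have Pi : m2.-integrable setT (fun w => (P w.1 w.2)%:E).
  exact: mul_fdiff_integrable phiK psiK.
have Qi : m2.-integrable setT (fun w => (Q w.1 w.2)%:E).
  exact: mul_fdiff_integrable psiK phiK.
have Psi := integrable_prod_swap Pi.
have Qsi := integrable_prod_swap Qi.
pose JP := (\int[m2]_w P w.1 w.2)%R.
pose JQ := (\int[m2]_w Q w.1 w.2)%R.
have JPE : \int[mu]_x (fgrad s i phi x * psi x) = JP.
  rewrite /JP /Rintegral -(integral_mul_fgrad i phiK psiK).
  by congr fine; apply: (@eq_integral _ T R mu setT) => x _; rewrite mulrC.
have JQE : \int[mu]_x (phi x * fgrad s i psi x) = JQ.
  by rewrite /JQ /Rintegral -(integral_mul_fgrad i psiK phiK).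
rewrite JPE JQE.
have JPs : \int[m2]_w P w.2 w.1 = JP.
  by rewrite /JP /Rintegral (integral_prod_swap Pi).
have JQs : \int[m2]_w Q w.2 w.1 = JQ.
  by rewrite /JQ /Rintegral (integral_prod_swap Qi).
have Phi := lip_csuppM phiK psiK.
have D0 : \int[m2]_w (2 * fdiff s i (phi \* psi) w.1 w.2) = 0.
  rewrite RintegralZl; [|exact: measurableT|exact: (fdiff_integrable s01 i Phi)].
  by rewrite /Rintegral (fdiff_mass_eq0 i Phi) mulr0.
have PQ w : 2 * fdiff s i (phi \* psi) w.1 w.2 =
    (P w.1 w.2 + P w.2 w.1) + (Q w.1 w.2 + Q w.2 w.1).
  rewrite /P /Q /fdiff /= -(opprB w.2 w.1) kappaN; ring.
have eP : \int[m2]_w (P w.1 w.2 + P w.2 w.1) = JP + JP.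
  by rewrite (RintegralD measurableT Pi Psi) JPs.
have eQ : \int[m2]_w (Q w.1 w.2 + Q w.2 w.1) = JQ + JQ.
  by rewrite (RintegralD measurableT Qi Qsi) JQs.
have : \int[m2]_w ((P w.1 w.2 + P w.2 w.1) + (Q w.1 w.2 + Q w.2 w.1)) = 0.
  by rewrite -D0; apply: eq_Rintegral => w _; rewrite PQ.
rewrite (RintegralD measurableT (integrableD measurableT Pi Psi)
  (integrableD measurableT Qi Qsi)) eP eQ.
exact: halve.
Qed.

End fractional_integration_by_parts.

(** * Test functions *)

Section derivatives_along_lines.
Context {R : realType} {n : nat}.
Local Notation E := 'rV[R]_n.+1.
Implicit Types (g : E -> R) (x v : E).

(** The difference quotients of the restriction to the line are literally those
    of the directional derivative. *)
Lemma is_derive_line g x v (t : R) : derivable g (x + t *: v) v ->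
  is_derive t 1 (fun tau : R => g (x + tau *: v)) ('D_v g (x + t *: v)).
Proof.
move=> dg.
have eqg : (fun h : R => h^-1 *: (((fun tau : R => g (x + tau *: v)) \o shift t)
      (h *: (1 : R)) - g (x + t *: v))) =
    (fun h => h^-1 *: ((g \o shift (x + t *: v)) (h *: v) - g (x + t *: v))).
  apply/funext => h /=; congr (_ *: (g _ - _)).
  by rewrite scalerDl [h *: 1]mulr1 addrCA.
apply: DeriveDef; first by rewrite /derivable eqg.
by rewrite /derive eqg.
Qed.

Lemma derive_grad g x v : differentiable g x -> 'D_v g x = dotv (grad g x) v.
Proof.
move=> dg; rewrite deriveE// [in LHS](row_sum_delta v) linear_sum.
apply: eq_bigr => i _.
by rewrite linearZ/= mxE /partial deriveE// mulrC.
Qed.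

End derivatives_along_lines.

Section test_functions.
Context {R : realType} {n : nat}.
Local Notation E := 'rV[R]_n.+1.

Lemma ltr_normD1 (z : R) : z < `|z| + 1.
Proof. by rewrite (le_lt_trans (ler_norm z))// ltrDl. Qed.

Lemma continuous_compact_supp_bounded (A : set E) (g : E -> R) :
  compact A -> continuous g -> (forall x, ~ A x -> g x = 0) ->
  exists2 M : R, 0 <= M & forall x, `|g x| <= M.
Proof.
move=> cA cg g0.
have : compact (g @` A).
  by apply: continuous_compact => //; exact: continuous_subspaceT.
move=> /compact_bounded[M [_ HM]].
have HM1 := HM (`|M| + 1) (ltr_normD1 M).
exists (`|M| + 1) => [|x]; first by rewrite addr_ge0.
have [Ax|/g0 ->] := pselect (A x); last by rewrite normr0 addr_ge0.
by apply: HM1; exists x.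
Qed.

(** The partial derivatives are continuous and vanish outside the compact support,
    hence are bounded; the mean value theorem on the segment from x to y
    does the rest. *)
Lemma test_function_lip_csupp (A : set E) (phi : E -> R) :
  test_function A phi -> exists K, lip_csupp phi K.
Proof.
move=> [sm co _]; set S := closure _ in co.
have cphi : continuous phi.
  by move=> x; apply: differentiable_continuous; exact: (sm [::]).
have phi0 x : ~ S x -> phi x = 0.
  by move=> Sx; apply: contra_notP Sx => /eqP px; exact: subset_closure.
have cpar i : continuous (partial i phi).
  by move=> x; apply: differentiable_continuous; exact: (sm [:: i]).
have par0 i x : ~ S x -> partial i phi x = 0.
  move=> Sx; rewrite /partial.
  have oS : open (~` S) by apply: closed_openC; exact: closed_closure.
  rewrite (@near_eq_derive _ _ _ _ (cst 0)) ?derive_cst//.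
  by move: (open_nbhs_nbhs (conj oS Sx)); apply: filterS => y /phi0.
have [M M0 HM] := continuous_compact_supp_bounded co cphi phi0.
have /choice[N HN] i : exists N : R, 0 <= N /\ forall x, `|partial i phi x| <= N.
  have [N N0 H] := continuous_compact_supp_bounded co (cpar i) (@par0 i).
  by exists N.
have [r [_ Hr]] := compact_bounded co.
have Hr1 := Hr (`|r| + 1) (ltr_normD1 r).
have N0 : 0 <= \sum_i N i by apply: sumr_ge0 => i _; exact: (HN i).1.
exists (M + \sum_i N i + (`|r| + 2)); split => [x y|x|x px].
- have [||c _] := @MVT_segment R (fun t : R => phi (x + t *: (y - x)))
      (fun t => 'D_(y - x) phi (x + t *: (y - x))) 0 1 ler01.
  + move=> t _; apply: is_derive_line; apply: diff_derivable; exact: (sm [::]).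
  + apply: continuous_subspaceT => t.
    apply: (@continuous_comp _ _ _ (fun t : R => x + t *: (y - x)) phi).
      apply: cvgD; first exact: cvg_cst.
      by apply: cvgZl; exact: cvg_id.
    exact: cphi.
  have xy : x + (y - x) = y by rewrite addrC subrK.
  rewrite scale1r scale0r addr0 xy subr0 mulr1 => e.
  rewrite distrC e derive_grad; last exact: (sm [::]).
  rewrite /dotv (le_trans (ler_norm_sum _ _ _))//.
  apply: (@le_trans _ _ ((\sum_i N i) * `|y - x|)).
    rewrite mulr_suml; apply: ler_sum => i _; rewrite normrM ler_pM//.
      by rewrite mxE (HN i).2.
    exact: coord_le_rnorm.
  by rewrite ler_wpM2r// -addrA addrCA lerDl; have := normr_ge0 r; lra.
- by apply: (le_trans (HM x)); have := normr_ge0 r; lra.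
- have Sx : S x by exact: subset_closure.
  have := Hr1 x Sx; rewrite /= => xr; have := normr_ge0 r; lra.
Qed.

End test_functions.

Section frac_grad_test_functions.
Context {R : realType} {n : nat}.
Local Notation E := 'rV[R]_n.+1.
Local Notation mu := (leb R n).
Local Notation T := (lebRd R n).
Variable s : R.
Hypothesis s01 : 0 < s < 1.

Lemma frac_grad_Lfun (phi : E -> R) K i r : 1 <= r -> lip_csupp phi K ->
  (fun x : T => frac_grad s phi x 0 i) \in Lfun mu r%:E.
Proof.
move=> r1 phiK.
have -> : (fun x : T => frac_grad s phi x 0 i) =
    (fun x => fgrad s i phi x * frac_const (n := n) s).
  by apply/funext => x; rewrite frac_gradE mulrC.
exact: (Lfun_scale _ r1 (fgrad_Lfun s01 i r1 phiK)).
Qed.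

(** Integration by parts is fgrad_antisymmetric multiplied by the constant of the
    fractional gradient. *)
Lemma is_frac_grad_test p (A : set E) (phi : E -> R) : 1 <= p -> test_function A phi ->
  is_frac_grad s p phi (frac_grad s phi).
Proof.
move=> p1 /test_function_lip_csupp[K phiK]; split.
  by move=> i; exact: frac_grad_Lfun phiK.
move=> psi /test_function_lip_csupp[L psiL] i.
have H := fgrad_antisymmetric s01 i phiK psiL.
set c := frac_const (n := n) s.
have fi := mul_bounded_integrable (fgrad_integrable s01 i phiK)
  (lip_csupp_measurable psiL) (M := L).
have fi' := mul_bounded_integrable (fgrad_integrable s01 i psiL)
  (lip_csupp_measurable phiK) (M := K).
transitivity (c * \int[mu]_x (fgrad s i phi x * psi x)).
  rewrite -RintegralZl; [|exact: measurableT|].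
    by apply: eq_Rintegral => x _; rewrite frac_gradE mulrA.
  by apply: fi; case: psiL.
rewrite H mulrN -RintegralZl; [|exact: measurableT|].
  by congr (- _); apply: eq_Rintegral => x _; rewrite frac_gradE mulrCA.
have := fi'; rewrite (_ : (fun x => _) = (fun x => phi x * fgrad s i psi x)).
  by apply; case: phiK.
by apply/funext => x; rewrite mulrC.
Qed.

End frac_grad_test_functions.

(** * Differentiation along a ray *)

Section convex_chain_rule.
Context {R : realType}.
Implicit Types (g : R -> R).

Definition convex_on_R g := forall x y l : R, 0 <= l <= 1 ->
  g (l * x + (1 - l) * y) <= l * g x + (1 - l) * g y.

(** The next two lemmas sandwich the slope of a convex function between 0 and t by
    slopes over intervals of fixed length e, on which pointwise limits can be
    taken. *)
Lemma convex_slope_le g (t e : R) : convex_on_R g -> 0 < t -> t <= e ->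
  (g t - g 0) / t <= (g e - g 0) / e.
Proof.
move=> cg t0 te; have e0 := lt_le_trans t0 te.
have l01 : 0 <= t / e <= 1.
  by rewrite divr_ge0 ?(ltW t0) ?(ltW e0)//= ler_pdivrMr// mul1r.
have := cg e 0 _ l01.
rewrite mulr0 addr0 mulfVK ?gt_eqF// => H.
rewrite ler_pdivrMr//.
have -> : (g e - g 0) / e * t = t / e * g e + (1 - t / e) * g 0 - g 0 by ring.
lra.
Qed.

Lemma convex_slope_ge g (t e : R) : convex_on_R g -> 0 < t -> 0 < e ->
  (g 0 - g (- e)) / e <= (g t - g 0) / t.
Proof.
move=> cg t0 e0; have te0 : 0 < t + e by rewrite addr_gt0.
have l01 : 0 <= t / (t + e) <= 1.
  by rewrite divr_ge0 ?(ltW t0) ?(ltW te0)//= ler_pdivrMr// mul1r lerDl ltW.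
have te : t + e != 0 by rewrite gt_eqF.
have := cg (- e) t _ l01.
have -> : t / (t + e) * - e + (1 - t / (t + e)) * t = 0 by field.
have -> : t / (t + e) * g (- e) + (1 - t / (t + e)) * g t =
  (t * g (- e) + e * g t) / (t + e) by field.
rewrite ler_pdivlMr// => H.
rewrite ler_pdivrMr// mulrAC ler_pdivlMr//; lra.
Qed.

Lemma is_derive_quotient_cvg g (D : R) (t : nat -> R) :
  is_derive (0 : R) 1 g D -> (forall k, t k != 0) -> t @ \oo --> (0 : R) ->
  (fun k => (g (t k) - g 0) / t k) @ \oo --> D.
Proof.
move=> dg t0 tc; have [/cvg_ex[l gl] gD] := dg.
have {gD} lD : l = D by rewrite -gD; exact/esym/cvg_lim.
rewrite lD in gl.
have : (fun k => (t k)^-1 *: ((g \o shift 0) (t k *: (1 : R)) - g 0)) @ \oo --> D.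
  apply: (cvg_comp t _ _ gl) => A; rewrite /dnbhs/= /within/=.
  move=> /tc; rewrite /nbhs/=; apply: filterS => k /= H; exact: H.
by under eq_fun do rewrite /= addr0 [_ *: 1]mulr1 [_ *: _]mulrC.
Qed.

(** The step t k and the function G k change together. Convexity decouples them:
    for a fixed step e the quotient of G k at t k lies between the quotients
    of G k at - e and e, which tend to those of g, which are close to D when
    e is small. *)
Lemma convex_quotient_cvg (G : nat -> R -> R) g (D : R) (t : nat -> R) :
  (forall k, convex_on_R (G k)) -> (forall x, G ^~ x @ \oo --> g x) ->
  is_derive (0 : R) 1 g D -> (forall k, 0 < t k) -> t @ \oo --> (0 : R) ->
  (fun k => (G k (t k) - G k 0) / t k) @ \oo --> D.
Proof.
move=> cG Gg dg t0 tc.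
have tn0 k : t k != 0 by rewrite gt_eqF.
have tNn0 k : - t k != 0 by rewrite oppr_eq0.
have tNc : (\- t) @ \oo --> (0 : R) by rewrite -[X in _ --> X]oppr0; exact: cvgN.
have q1 := is_derive_quotient_cvg dg tn0 tc.
have q2 := is_derive_quotient_cvg dg tNn0 tNc.
apply/cvgrPdist_lt => e e0.
have e20 : 0 < e / 2 by rewrite divr_gt0.
(* A term of the sequence itself serves as the fixed step. *)
have [j [j1 j2]] : exists j, `|D - (g (t j) - g 0) / t j| < e / 2 /\
    `|D - (g (- t j) - g 0) / (- t j)| < e / 2.
  near \oo => j; exists j; split; near: j.
    by move/cvgrPdist_lt : q1; apply.
  by move/cvgrPdist_lt : q2; apply.
have r1 : (fun k => (G k (t j) - G k 0) / t j) @ \oo --> (g (t j) - g 0) / t j.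
  by apply: cvgMl; apply: cvgB; exact: Gg.
have r2 : (fun k => (G k 0 - G k (- t j)) / t j) @ \oo --> (g 0 - g (- t j)) / t j.
  by apply: cvgMl; apply: cvgB; exact: Gg.
near=> k.
have tk : t k <= t j.
  apply: ltW; near: k; have := tc => /cvgrPdist_lt/(_ _ (t0 j)).
  by apply: filterS => k; rewrite sub0r normrN; apply: le_lt_trans; exact: ler_norm.
have h1 := convex_slope_le (cG k) (t0 k) tk.
have h2 := convex_slope_ge (cG k) (t0 k) (t0 j).
have h3 : `|(g (t j) - g 0) / t j - (G k (t j) - G k 0) / t j| < e / 2.
  by near: k; move/cvgrPdist_lt : r1; apply.
have h4 : `|(g 0 - g (- t j)) / t j - (G k 0 - G k (- t j)) / t j| < e / 2.
  by near: k; move/cvgrPdist_lt : r2; apply.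
have eN : (g (- t j) - g 0) / (- t j) = (g 0 - g (- t j)) / t j.
  by rewrite invrN mulrN -mulNr opprB.
rewrite eN in j2.
move: j1 j2 h1 h2 h3 h4.
move: ((g (t j) - g 0) / t j) ((g 0 - g (- t j)) / t j)
  ((G k (t k) - G k 0) / t k) ((G k (t j) - G k 0) / t j)
  ((G k 0 - G k (- t j)) / t j) => A B X Y Z.
rewrite !ltr_norml => /andP[? ?] /andP[? ?] ? ? /andP[? ?] /andP[? ?].
apply/andP; split; lra.
Unshelve. all: by end_near. Qed.

Context {n : nat}.
Local Notation E := 'rV[R]_n.+1.

Lemma convex_function_line (h : E -> R) (xi eta : E) :
  @convex_function R E setT h -> convex_on_R (fun tau => h (xi + tau *: eta)).
Proof.
move=> ch x y l /andP[l0 l1].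
have := ch (Itv01 l0 l1) (xi + x *: eta) (xi + y *: eta).
move=> /(_ (mem_set I) (mem_set I)).
suff -> : xi + (l * x + (1 - l) * y) *: eta =
  l *: (xi + x *: eta) + (1 - l) *: (xi + y *: eta) by [].
have l1E : l + (1 - l) = 1 by ring.
rewrite !scalerDr addrACA -scalerDl l1E scale1r.
by rewrite !scalerA -scalerDl.
Qed.

(** Separate differentiability in z and in xi does not imply differentiability
    along a ray. Here it does because F is convex in xi: the part of
    the increment in xi is taken at the moving point z + t phi, and
    convex_quotient_cvg handles it. *)
Lemma chain_rule_along_ray (F : R -> E -> R) (z phi : R) (xi eta : E) (t : nat -> R) :
  (forall z', @convex_function R E setT (F z')) ->
  (forall xi', derivable (F ^~ xi') z 1) -> differentiable (F z) xi ->
  (forall k, 0 < t k) -> t @ \oo --> (0 : R) ->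
  (fun k => (F (z + t k * phi) (xi + t k *: eta) - F z xi) / t k) @ \oo -->
    derive1 (F ^~ xi) z * phi + dotv (grad (F z) xi) eta.
Proof.
move=> cF dF dxi t0 tc.
have ztc : (fun k => z + t k * phi) @ \oo --> z.
  rewrite -[X in _ --> X]addr0 -(mul0r phi).
  by apply: cvgD; [exact: cvg_cst|exact: cvgMl].
have dline : is_derive (0 : R) 1 (fun tau => F z (xi + tau *: eta))
    (dotv (grad (F z) xi) eta).
  have d0 : differentiable (F z) (xi + 0 *: eta) by rewrite scale0r addr0.
  have dd : derivable (F z) (xi + 0 *: eta) eta by exact: diff_derivable.
  by have := is_derive_line dd; rewrite (derive_grad eta d0) scale0r addr0.
have q2 : (fun k => (F (z + t k * phi) (xi + t k *: eta) -
    F (z + t k * phi) (xi + 0 *: eta)) / t k) @ \oo --> dotv (grad (F z) xi) eta.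
  apply: (@convex_quotient_cvg
    (fun k tau => F (z + t k * phi) (xi + tau *: eta)) _ _ _ _ _ dline t0 tc).
  - by move=> k; exact: convex_function_line.
  - move=> tau; have /derivable1_diffP/differentiable_continuous := dF (xi + tau *: eta).
    exact: (@cvg_comp _ _ _ (fun k => z + t k * phi) (F ^~ (xi + tau *: eta))
      \oo _ _ ztc).
have q1 : (fun k => (F (z + t k * phi) xi - F (z + 0 * phi) xi) / t k) @ \oo -->
    derive1 (F ^~ xi) z * phi.
  apply: (@is_derive_quotient_cvg (fun tau => F (z + tau * phi) xi)) => //; last first.
    by move=> k; rewrite gt_eqF.
  have dg : is_derive (0 : R) 1 (fun tau : R => z + tau * phi) phi.
    by apply: is_derive_eq; rewrite scale0r !add0r mul1r [_ *: _]mulr1.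
  apply: (@is_derive1_comp R (F ^~ xi) (fun tau : R => z + tau * phi)) dg.
  rewrite mul0r addr0 derive1E; exact: derivableP.
rewrite (_ : (fun k => _) = (fun k =>
    (F (z + t k * phi) xi - F (z + 0 * phi) xi) / t k +
    (F (z + t k * phi) (xi + t k *: eta) -
     F (z + t k * phi) (xi + 0 *: eta)) / t k)); first exact: cvgD q1 q2.
apply/funext => k.
by rewrite mul0r scale0r !addr0 -mulrDl; congr (_ / _); ring.
Qed.

End convex_chain_rule.

(** * Limits of integrals *)

Section limits_of_integrals.
Context d (T : measurableType d) (R : realType) (m : {measure set T -> \bar R}).

Lemma ae_imply (P Q : T -> Prop) :
  {ae m, forall x, P x} -> (forall x, P x -> Q x) -> {ae m, forall x, Q x}.
Proof. by move=> aP PQ; apply: filterS aP. Qed.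

Lemma ae_and (P Q : T -> Prop) :
  {ae m, forall x, P x} -> {ae m, forall x, Q x} -> {ae m, forall x, P x /\ Q x}.
Proof. by move=> aP aQ; apply: filterS2 aP aQ. Qed.

Lemma ae_dominated_integrable (f g : T -> R) :
  measurable_fun setT f -> {ae m, forall x, `|f x| <= g x} ->
  m.-integrable setT (EFin \o g) -> m.-integrable setT (EFin \o f).
Proof.
move=> mf fg gi; have mg := measurable_int _ gi.
apply: integrable_EFin_lty => //.
have [_ glt] := integrableP _ _ _ gi.
apply: le_lt_trans glt; apply: ae_ge0_le_integral => //.
- by apply/measurable_EFinP; exact: measurableT_comp.
- exact: measurableT_comp.
- by apply: filterS fg => x fgx _; rewrite lee_fin (le_trans fgx)// ler_norm.
Qed.

(** The integral of the negative part is bounded by that of g, so the integral is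
    the integral of the positive part up to a finite amount. *)
Lemma ae_bounded_below_integrable (f g : T -> R) :
  measurable_fun setT f -> m.-integrable setT (EFin \o g) ->
  {ae m, forall x, g x <= f x} -> (\int[m]_x (f x)%:E < +oo)%E ->
  m.-integrable setT (EFin \o f).
Proof.
move=> mf gi gf fi; have mg := measurable_int _ gi.
have mF : measurable_fun setT (EFin \o f) by exact/measurable_EFinP.
have neglt : (\int[m]_x (EFin \o f)^\- x < +oo)%E.
  have [_ glt] := integrableP _ _ _ gi.
  apply: le_lt_trans glt; apply: ae_ge0_le_integral => //.
  - exact: measurable_funeneg.
  - exact: measurableT_comp.
  - apply: filterS gf => x gfx _; rewrite funenegE/= ge_max !lee_fin normr_ge0 andbT.
    by rewrite (@le_trans _ _ (- g x))// ?lerN2// -normrN ler_norm.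
have posE : (\int[m]_x (EFin \o f)^\+ x < +oo)%E.
  rewrite ltey; apply/eqP => py; move: fi; rewrite integralE py.
  have : (\int[m]_x (EFin \o f)^\- x \is a fin_num)%E.
    by rewrite ge0_fin_numE// integral_ge0.
  by move=> /fineK <-.
apply/integrableP; split => //.
rewrite -[X in integral _ _ X]/(abse \o (EFin \o f)) fune_abse ge0_integralD//.
- exact: lte_add_pinfty.
- exact: measurable_funepos.
- exact: measurable_funeneg.
Qed.

Hypothesis m_complete : measure_is_complete m.

(** The superior limit is measurable and almost everywhere equal to h, and
    completeness transfers measurability to h. *)
Lemma ae_cvg_measurable (q : nat -> T -> R) (h : T -> R) :
  (forall k, measurable_fun setT (q k)) ->
  {ae m, forall x, q ^~ x @ \oo --> h x} -> measurable_fun setT h.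
Proof.
move=> mq qh; apply/measurable_EFinP.
pose h' x := limn_esup (fun k => (q k x)%:E).
have mh' : measurable_fun setT h'.
  by apply: measurable_fun_limn_esup => k; exact/measurable_EFinP.
apply: (ae_measurable_fun m_complete _ mh').
apply: filterS qh => x qx _; rewrite /h'.
have qE : (fun k => (q k x)%:E) @ \oo --> (h x)%:E.
  by apply: cvg_EFin => //; exact: nearW.
by rewrite is_cvg_limn_esupE; [exact/cvg_lim|apply/cvg_ex; eexists; exact: qE].
Qed.

Lemma dominated_limit_ge0 (q : nat -> T -> R) (h G : T -> R) :
  (forall k, measurable_fun setT (q k)) ->
  {ae m, forall x, q ^~ x @ \oo --> h x} ->
  m.-integrable setT (EFin \o G) ->
  {ae m, forall x k, `|q k x| <= G x} ->
  (forall k, 0 <= \int[m]_x (q k x)%:E)%E ->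
  m.-integrable setT (EFin \o h) /\ 0 <= \int[m]_x h x.
Proof.
move=> mq qh Gi qG q0; have mh := ae_cvg_measurable mq qh.
have mqE k : measurable_fun setT (EFin \o q k) by exact/measurable_EFinP.
have mhE : measurable_fun setT (EFin \o h) by exact/measurable_EFinP.
have qhE : {ae m, forall x, setT x -> (EFin \o q k) x @[k --> \oo] --> (EFin \o h) x}.
  by apply: filterS qh => x qx _; apply: cvg_EFin => //; exact: nearW.
have qGE : {ae m, forall x k, setT x -> (`|(EFin \o q k) x| <= (EFin \o G) x)%E}.
  by apply: filterS qG => x qx k _; rewrite lee_fin.
have [hi _ cI] := dominated_convergence measurableT mqE mhE qhE Gi qGE.
split => //; rewrite -lee_fin (Rintegral_EFin hi).
by rewrite -(cvg_lim _ cI)//; apply: lime_ge; [apply/cvg_ex; eexists; exact: cI|exact: nearW].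
Qed.

End limits_of_integrals.

(** * Growth conditions and conjugate exponents *)

Section young_type_bounds.
Context {R : realType}.
Variable p : R.
Hypothesis p1 : 1 < p.

Lemma conjugate_exponent_gt1 : 1 < p / (p - 1).
Proof. by rewrite ltr_pdivlMr ?subr_gt0// mul1r gtrBl. Qed.

(** Young's inequality without its constants 1/p and 1/q, which are at most 1. *)
Lemma young_le (a b : R) : 0 <= a -> 0 <= b ->
  a * b <= a `^ p + b `^ (p / (p - 1)).
Proof.
move=> a0 b0; have p0 : 0 < p by apply: lt_trans p1.
have q1 := conjugate_exponent_gt1; have q0 : 0 < p / (p - 1) := lt_trans ltr01 q1.
have pq : p^-1 + (p / (p - 1))^-1 = 1.
  by rewrite invf_div; field; rewrite gt_eqF.
apply: (le_trans (conjugate_powR a0 b0 p0 q0 pq)).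
by rewrite lerD// ler_pdivrMr// ler_peMr ?powR_ge0// ltW.
Qed.

End young_type_bounds.

Section conjugate_pairing.
Context d (T : measurableType d) (R : realType) (m : {measure set T -> \bar R}).
Variable p : R.
Hypothesis p1 : 1 < p.

Lemma Lfun_mul_integrable (f g : T -> R) :
  f \in Lfun m p%:E -> g \in Lfun m (p / (p - 1))%:E ->
  m.-integrable setT (EFin \o (fun x => f x * g x)).
Proof.
move=> fp gq.
have fi := Lfun_integrable (ltW p1) fp.
have gi := Lfun_integrable (ltW (conjugate_exponent_gt1 p1)) gq.
apply: (@dominated_integrable_EFin _ _ _ m _
  (fun x => `|f x| `^ p + `|g x| `^ (p / (p - 1)))).
- exact: (measurable_funM (Lfun_measurable fp) (Lfun_measurable gq)).
- by move=> x; rewrite normrM; exact: young_le.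
- exact: (integrableD measurableT fi gi).
Qed.

End conjugate_pairing.

Section mean_value.
Context {R : realType}.

Lemma mean_value_le (g dg : R -> R) (B : R) :
  (forall t : R, is_derive t 1 g (dg t)) ->
  (forall t : R, 0 <= t <= 1 -> `|dg t| <= B) -> `|g 1 - g 0| <= B.
Proof.
move=> dgE dgB.
have [|c] := @MVT_segment R g dg 0 1 ler01.
  apply: continuous_subspaceT => t.
  apply: differentiable_continuous; apply/derivable1_diffP; by have [] := dgE t.
by rewrite in_itv/= subr0 mulr1 => c01 ->; exact: dgB.
Qed.

End mean_value.

(** * Competitors and increments of the integrand *)

Lemma coord_addZ (R : realType) n (x y : 'rV[R]_n.+1) (c : R) i :
  (x + c *: y) 0 i = x 0 i + c * y 0 i.
Proof. by rewrite !mxE. Qed.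

Section competitors.
Context {R : realType} {n : nat}.
Local Notation E := 'rV[R]_n.+1.
Local Notation mu := (leb R n).
Local Notation T := (lebRd R n).
Variables s p : R.
Hypothesis s01 : 0 < s < 1.
Hypothesis p1 : 1 < p.

Lemma is_frac_grad_perturb (u phi : E -> R) (Du : E -> E) (A : set E) (c : R) :
  (u : T -> R) \in Lfun mu p%:E -> is_frac_grad s p u Du -> test_function A phi ->
  is_frac_grad s p (fun x => u x + c * phi x)
    (fun x => Du x + c *: frac_grad s phi x).
Proof.
move=> uL [DuL Du_ibp] phiT.
have p1E : (1 <= p%:E :> \bar R)%E by rewrite lee_fin ltW.
have q1 := ltW (conjugate_exponent_gt1 p1).
have [DphiL Dphi_ibp] := is_frac_grad_test s01 (ltW p1) phiT.
have [K phiK] := test_function_lip_csupp phiT.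
split => [i|psi psiT i].
  rewrite (_ : (fun x : T => _) = ((fun x => Du x 0 i) : T -> R) +
      ((fun x => frac_grad s phi x 0 i * c) : T -> R)).
    exact: (Lfun_addr_closed mu p1E).2 (DuL i) (Lfun_scale c (ltW p1) (DphiL i)).
  by apply/funext => x; rewrite coord_addZ (mulrC c).
have [L psiL] := test_function_lip_csupp psiT.
have psiq := lip_csupp_Lfun q1 psiL.
have Dpsiq := frac_grad_Lfun s01 i q1 psiL.
have i1 := Lfun_mul_integrable p1 (DuL i) psiq.
have i2 := Lfun_mul_integrable p1 (DphiL i) psiq.
have i3 := Lfun_mul_integrable p1 uL Dpsiq.
have i4 := Lfun_mul_integrable p1 (lip_csupp_Lfun (ltW p1) phiK) Dpsiq.
have i2' := integrableZl measurableT c i2.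
have i4' := integrableZl measurableT c i4.
transitivity (\int[mu]_x (Du x 0 i * psi x) +
    c * \int[mu]_x (frac_grad s phi x 0 i * psi x)).
  rewrite -(RintegralZl _ measurableT i2) -(RintegralD measurableT i1 i2').
  by apply: eq_Rintegral => x _; rewrite coord_addZ mulrDl mulrA.
rewrite Du_ibp// Dphi_ibp// mulrN -opprD; congr (- _).
rewrite -(RintegralZl _ measurableT i4) -(RintegralD measurableT i3 i4').
by apply: eq_Rintegral => x _; rewrite mulrDl mulrA.
Qed.

Lemma Hspg_perturb (u phi : E -> R) (Du : E -> E) (Omega : set E) g (c : R) :
  Hspg s p Omega g u -> is_frac_grad s p u Du -> test_function Omega phi ->
  Hspg s p Omega g (fun x => u x + c * phi x).
Proof.
move=> [[uL _] ug] uDu phiT; split; last first.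
  apply: (ae_imply ug) => x ugx xO; rewrite ugx// (_ : phi x = 0) ?mulr0 ?addr0//.
  have [_ _ supp] := phiT; apply: contra_notP xO => /eqP px.
  by apply: supp; exact: subset_closure.
have [K phiK] := test_function_lip_csupp phiT.
split; last by exists (fun x => Du x + c *: frac_grad s phi x);
  exact: is_frac_grad_perturb uL uDu phiT.
have p1E : (1 <= p%:E :> \bar R)%E by rewrite lee_fin ltW.
rewrite (_ : (fun x : T => _) = (u : T -> R) + ((fun x => phi x * c) : T -> R)).
  exact: (Lfun_addr_closed mu p1E).2 uL (Lfun_scale c (ltW p1) (lip_csupp_Lfun (ltW p1) phiK)).
by apply/funext => x; rewrite mulrC.
Qed.

End competitors.

Section increments.
Context {R : realType} {n : nat}.
Local Notation E := 'rV[R]_n.+1.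
Variable p : R.
Hypothesis p1 : 1 < p.

(** Bounds |z + t phi|, |phi|, the Euclidean norm of xi + t eta and the sum of the
    |eta_i| when t is in [0, 1]. *)
Definition increment_size (z phi : R) (xi eta : E) : R :=
  `|z| + `|phi| + (\sum_i `|xi 0 i| + \sum_i `|eta 0 i|).

(** S S^(p-1) = S^p and S |g| <= S^p + |g|^(p/(p-1)): an increment of size S times a
    derivative with the growth condition is integrable when S is in L^p and g in the
    conjugate space. *)
Lemma growth_le (C S z g : R) (xi : E) : `|z| <= S -> enorm xi <= S ->
  S * (C * (`|z| `^ (p - 1) + enorm xi `^ (p - 1)) + g) <=
  (2 * `|C| + 1) * S `^ p + `|g| `^ (p / (p - 1)).
Proof.
move=> zS xS; have S0 : 0 <= S := le_trans (normr_ge0 _) zS.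
have p0 : 0 < p by apply: lt_trans p1.
have P0 : 0 <= p - 1 by rewrite subr_ge0 ltW.
have mono (w : R) : 0 <= w -> w <= S -> w `^ (p - 1) <= S `^ (p - 1).
  by move=> w0 wS; apply: ge0_ler_powR; rewrite ?nnegrE.
have H1 := mono _ (normr_ge0 z) zS.
have H2 := mono _ (enorm_ge0 xi) xS.
have SSp : S * S `^ (p - 1) = S `^ p by exact: mulr_powRB1.
have young := young_le p1 S0 (normr_ge0 g).
apply: (@le_trans _ _ (S * (`|C| * (2 * S `^ (p - 1)) + `|g|))).
  rewrite ler_wpM2l// lerD ?ler_norm// (le_trans (ler_norm _))// normrM.
  rewrite ler_wpM2l// ger0_norm ?addr_ge0 ?powR_ge0//; lra.
have -> : S * (`|C| * (2 * S `^ (p - 1)) + `|g|) =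
  2 * `|C| * (S * S `^ (p - 1)) + S * `|g| by ring.
rewrite SSp; lra.
Qed.

(** The mean value theorem in z at the fixed point xi + t eta, then in xi at the fixed
    point z. The bound is t times a function that does not depend on t, as
    dominated convergence requires. *)
Lemma increment_le (F : R -> E -> R) (C g2 g3 z phi t : R) (xi eta : E) :
  (forall z' xi', derivable (F ^~ xi') z' 1 /\ differentiable (F z') xi') ->
  (forall z' xi', `|derive1 (F ^~ xi') z'| <=
     C * (`|z'| `^ (p - 1) + enorm xi' `^ (p - 1)) + g2) ->
  (forall z' xi', enorm (grad (F z') xi') <=
     C * (`|z'| `^ (p - 1) + enorm xi' `^ (p - 1)) + g3) ->
  0 <= t <= 1 ->
  `|F (z + t * phi) (xi + t *: eta) - F z xi| <=
  t * (2 * (2 * `|C| + 1) * increment_size z phi xi eta `^ p +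
       (`|g2| `^ (p / (p - 1)) + `|g3| `^ (p / (p - 1)))).
Proof.
move=> dF Fz Fxi /andP[t0 t1]; set S := increment_size z phi xi eta.
have Sxi : 0 <= \sum_i `|xi 0 i| by exact: sumr_ge0.
have Seta : 0 <= \sum_i `|eta 0 i| by exact: sumr_ge0.
have S_phi : `|phi| <= S.
  by rewrite /S /increment_size; have := normr_ge0 z; lra.
have S_eta : \sum_i `|eta 0 i| <= S.
  by rewrite /S /increment_size; have := normr_ge0 z; have := normr_ge0 phi; lra.
have S_z (r : R) : 0 <= r <= 1 -> `|z + r * phi| <= S.
  move=> /andP[r0 r1]; apply: (le_trans (ler_normD _ _)).
  rewrite normrM (ger0_norm r0) /S /increment_size.
  by have : r * `|phi| <= `|phi| by [rewrite ler_piMl]; lra.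
have S_xi (r : R) : 0 <= r <= 1 -> enorm (xi + r *: eta) <= S.
  move=> /andP[r0 r1]; apply: (le_trans (enorm_le_sum _)).
  apply: (@le_trans _ _ (\sum_i `|xi 0 i| + \sum_i `|eta 0 i|)); last first.
    by rewrite /S /increment_size; have := normr_ge0 z; have := normr_ge0 phi; lra.
  rewrite -big_split/=; apply: ler_sum => i _.
  rewrite coord_addZ (le_trans (ler_normD _ _))// lerD2l normrM (ger0_norm r0).
  by rewrite ler_piMl.
have sub01 (r : R) : 0 <= r <= 1 -> 0 <= r * t <= 1.
  by move=> /andP[r0 r1]; rewrite mulr_ge0//= mulr_ile1.
have t01 : 0 <= t <= 1 by rewrite t0.
have z01 : (0 <= 0 :> R) && (0 <= 1 :> R) by rewrite lexx ler01.
have step1 : `|F (z + t * phi) (xi + t *: eta) - F z (xi + t *: eta)| <=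
    t * ((2 * `|C| + 1) * S `^ p + `|g2| `^ (p / (p - 1))).
  have der (r : R) : is_derive r 1 (fun r : R => F (z + r * (t * phi)) (xi + t *: eta))
      (derive1 (F ^~ (xi + t *: eta)) (z + r * (t * phi)) * (t * phi)).
    have dg : is_derive r 1 (fun r : R => z + r * (t * phi)) (t * phi).
      by apply: is_derive_eq; rewrite scaler0 !add0r mul1r [_ *: _]mulr1.
    apply: (@is_derive1_comp R (F ^~ (xi + t *: eta))
      (fun r : R => z + r * (t * phi))) dg.
    by rewrite derive1E; apply: derivableP; exact: (dF _ _).1.
  have := mean_value_le der (B := t * ((2 * `|C| + 1) * S `^ p + `|g2| `^ (p / (p - 1)))).
  rewrite mul1r mul0r addr0; apply => r r01.
  have rt := S_z _ (sub01 _ r01).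
  rewrite normrM normrM (ger0_norm t0) mulrCA ler_wpM2l// mulrC.
  apply: (le_trans _ (growth_le C g2 rt (S_xi _ t01))).
  by rewrite mulrA ler_pM.
have step2 : `|F z (xi + t *: eta) - F z xi| <=
    t * ((2 * `|C| + 1) * S `^ p + `|g3| `^ (p / (p - 1))).
  have der (r : R) : is_derive r 1 (fun r : R => F z (xi + r *: (t *: eta)))
      (dotv (grad (F z) (xi + r *: (t *: eta))) (t *: eta)).
    rewrite -derive_grad; last exact: (dF _ _).2.
    by apply: is_derive_line; apply: diff_derivable; exact: (dF _ _).2.
  have := mean_value_le der (B := t * ((2 * `|C| + 1) * S `^ p + `|g3| `^ (p / (p - 1)))).
  rewrite scale1r scale0r addr0; apply => r r01.
  apply: (le_trans (dotv_le _ _)).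
  have -> : \sum_i `|(t *: eta) 0 i| = t * \sum_i `|eta 0 i|.
    by rewrite mulr_sumr; apply: eq_bigr => i _; rewrite mxE normrM (ger0_norm t0).
  rewrite mulrCA ler_wpM2l// mulrC.
  have := growth_le C g3 (S_z _ z01) (S_xi _ (sub01 _ r01)).
  rewrite mul0r addr0 -scalerA; apply: le_trans.
  by rewrite ler_pM ?enorm_ge0.
rewrite -(subrK (F z (xi + t *: eta)) (F (z + t * phi) _)) -addrA.
apply: (le_trans (ler_normD _ _)); apply: (le_trans (lerD step1 step2)).
by rewrite -mulrDr ler_wpM2l//; lra.
Qed.

End increments.

(** * The variation of the functional *)

Section one_sided_variation.
Context d (T : measurableType d) (R : realType) (m : {measure set T -> \bar R}).
Hypothesis m_complete : measure_is_complete m.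

(** The first variation at a minimum: the quotients (f k - f0) / t k have nonnegative
    integrals and are dominated by G, so their limit has a nonnegative
    integral. *)
Lemma directional_derivative_ge0 (f0 h G : T -> R) (f : nat -> T -> R)
    (t : nat -> R) :
  (forall k, 0 < t k) -> m.-integrable setT (EFin \o f0) ->
  (forall k, measurable_fun setT (f k)) -> m.-integrable setT (EFin \o G) ->
  {ae m, forall x, forall k, `|f k x - f0 x| <= t k * G x} ->
  {ae m, forall x, (fun k => (f k x - f0 x) / t k) @ \oo --> h x} ->
  (forall k, \int[m]_x (f0 x)%:E <= \int[m]_x (f k x)%:E)%E ->
  m.-integrable setT (EFin \o h) /\ 0 <= \int[m]_x h x.
Proof.
move=> t0 f0i mf Gi fG fh f0_min.
have mf0 : measurable_fun setT f0 by apply/measurable_EFinP; exact: measurable_int f0i.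
have mq k : measurable_fun setT (fun x => (f k x - f0 x) / t k).
  by apply: measurable_funM => //; exact: measurable_funB.
have qG : {ae m, forall x k, `|(f k x - f0 x) / t k| <= G x}.
  apply: (ae_imply fG) => x H k.
  by rewrite normrM normfV (gtr0_norm (t0 k)) ler_pdivrMr// mulrC.
apply: (dominated_limit_ge0 m_complete mq fh Gi qG) => k.
have di : m.-integrable setT (EFin \o (fun x => f k x - f0 x)).
  apply: (@ae_dominated_integrable _ _ _ m _ (fun x => t k * G x)).
  - exact: measurable_funB.
  - by apply: (ae_imply fG) => x.
  - exact: (integrableZl measurableT (t k) Gi).
have fki : m.-integrable setT (EFin \o f k).
  have := integrableD measurableT di f0i.
  by apply: eq_integrable => // x _ /=; rewrite -EFinD subrK.
under eq_integral do rewrite EFinM.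
rewrite (integralZr measurableT di); apply: mule_ge0; last first.
  by rewrite lee_fin invr_ge0 ltW.
by rewrite (integralB_EFin measurableT fki f0i) suber_ge0// (integrable_fin_num measurableT f0i).
Qed.

End one_sided_variation.

Section Lfun_sums.
Context d (T : measurableType d) (R : realType) (m : {measure set T -> \bar R}).
Variable p : R.
Hypothesis p1 : 1 <= p.

Lemma Lfun_normr (f : T -> R) :
  f \in Lfun m p%:E -> (fun x => `|f x|) \in Lfun m p%:E.
Proof.
move=> fL; have mf := Lfun_measurable fL.
apply: Lfun_powR_integrable; first by rewrite gt_eqF// (lt_le_trans ltr01).
  exact: measurableT_comp.
by under eq_fun do rewrite normr_id; exact: Lfun_integrable.
Qed.

Lemma Lfun_add (f g : T -> R) :
  f \in Lfun m p%:E -> g \in Lfun m p%:E -> (fun x => f x + g x) \in Lfun m p%:E.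
Proof.
have p1E : (1 <= p%:E :> \bar R)%E by rewrite lee_fin.
exact: (Lfun_addr_closed m p1E).2.
Qed.

Lemma Lfun_sum (I : Type) (r : seq I) (f : I -> T -> R) :
  (forall i, f i \in Lfun m p%:E) -> (fun x => \sum_(i <- r) f i x) \in Lfun m p%:E.
Proof.
move=> fL; have p1E : (1 <= p%:E :> \bar R)%E by rewrite lee_fin.
elim: r => [|i r IHr].
  under eq_fun do rewrite big_nil.
  exact: (Lfun_addr_closed m p1E).1.
by under eq_fun do rewrite big_cons; exact: Lfun_add.
Qed.

End Lfun_sums.

Section superposition.
Context {R : realType} {n : nat}.
Local Notation E := 'rV[R]_n.+1.
Local Notation T := (lebRd R n).

Lemma measurable_superposition (f : E -> R -> E -> R) (u : T -> R) (v : T -> E) :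
  measurable_fun [set: lebRd R n * borelRRd R n]
    (fun w => f w.1 (w.2 : R * E).1 (w.2 : R * E).2) ->
  measurable_fun setT u -> (forall i, measurable_fun setT (fun x => v x 0 i)) ->
  measurable_fun setT (fun x : T => f x (u x) (v x)).
Proof.
move=> mf mu mv.
exact: (measurableT_comp mf
  (measurable_fun_pair (@measurable_id _ T setT) (measurable_pair_borel mu mv))).
Qed.

End superposition.

Lemma leb_complete (R : realType) (n : nat) : measure_is_complete (leb R n).
Proof. exact: measure_is_complete_caratheodory. Qed.

Lemma coordZ (R : realType) n (x : 'rV[R]_n.+1) (c : R) i :
  (c *: x) 0 i = x 0 i * c.
Proof. by rewrite mxE mulrC. Qed.

Lemma dotvZr (R : realType) n (x y : 'rV[R]_n.+1) (c : R) :
  dotv x (c *: y) = c * dotv x y.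
Proof. by rewrite /dotv mulr_sumr; apply: eq_bigr => i _; rewrite coordZ mulrA mulrC. Qed.

Theorem theorem1p13 (R : realType) (n : nat) (Omega : set 'rV[R]_n.+1)
    (s p b C : R) (g : 'rV[R]_n.+1 -> R)
    (f : 'rV[R]_n.+1 -> R -> 'rV[R]_n.+1 -> R)
    (a gamma1 gamma2 gamma3 : 'rV[R]_n.+1 -> R) (u : 'rV[R]_n.+1 -> R)
    (OmegaB : bounded_set Omega) (OmegaO : open Omega)
    (s01 : 0 < s < 1) (p1 : 1 < p) (gH : Hsp s p g)
    (f_meas : measurable_fun [set: lebRd R n * borelRRd R n]
       (fun w => f w.1 (w.2 : R * 'rV[R]_n.+1).1 (w.2 : R * 'rV[R]_n.+1).2))
    (f_lsc : {ae leb R n, forall x, lower_semicontinuous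
       (fun zxi : R * 'rV[R]_n.+1 => (f x zxi.1 zxi.2)%:E)})
    (f_conv : {ae leb R n, forall x, forall z,
       @convex_function R 'rV[R]_n.+1 setT (f x z)})
    (aL1 : a \in Lfun (leb R n) 1%:E) (b0 : 0 < b)
    (f_coer : {ae leb R n, forall x, forall z xi,
       a x + b * enorm xi `^ p <= f x z xi})
    (f_fin : exists u0 Du0, [/\ Hspg s p Omega g u0,
       is_frac_grad s p u0 Du0 & Fs f u0 Du0 \is a fin_num])
    (f_diff : {ae leb R n, forall x, forall z xi,
       derivable (fun z' => f x z' xi) z 1 /\ differentiable (f x z) xi})
    (gamma1L : gamma1 \in Lfun (leb R n) (p / (p - 1))%:E)
    (gamma2L : gamma2 \in Lfun (leb R n) (p / (p - 1))%:E)
    (gamma3L : gamma3 \in Lfun (leb R n) (p / (p - 1))%:E)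
    (f_growth : {ae leb R n, forall x, forall z xi,
       `|f x z xi| <= C * (`|z| `^ p + enorm xi `^ p) + gamma1 x})
    (fz_growth : {ae leb R n, forall x, forall z xi,
       `|derive1 (fun z' => f x z' xi) z|
         <= C * (`|z| `^ (p - 1) + enorm xi `^ (p - 1)) + gamma2 x})
    (fxi_growth : {ae leb R n, forall x, forall z xi,
       enorm (grad (f x z) xi)
         <= C * (`|z| `^ (p - 1) + enorm xi `^ (p - 1)) + gamma3 x})
    (u_min : is_minimizer s p Omega g f u) :
  forall Du phi, is_frac_grad s p u Du -> test_function Omega phi ->
    let h x := derive1 (fun z => f x z (Du x)) (u x) * phi x
               + dotv (grad (f x (u x)) (Du x)) (frac_grad s phi x) in
    (leb R n).-integrable setT (EFin \o h) /\ \int[leb R n]_x h x = 0.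
Proof.
move=> Du phi uDu phiT h.
have p1' : 1 <= p := ltW p1.
have [uH u_le] := u_min.
have uL : (u : lebRd R n -> R) \in Lfun (leb R n) p%:E by case: uH => -[].
have DuL := uDu.1.
have [K phiK] := test_function_lip_csupp phiT.
have phiL := lip_csupp_Lfun p1' phiK.
have DphiL i := frac_grad_Lfun s01 i p1' phiK.
pose f0 (x : lebRd R n) := f x (u x) (Du x).
have mu := Lfun_measurable uL.
have mDu i := Lfun_measurable (DuL i).
(* F_s(u) is finite: comparison with u0 bounds it from above, coercivity from
   below. *)
have f0i : (leb R n).-integrable setT (EFin \o f0).
  apply: (@ae_bounded_below_integrable _ (lebRd R n) R (leb R n) f0 a).
  - exact: (measurable_superposition f_meas mu mDu).
  - exact/Lfun1_integrable.
  - apply: (ae_imply f_coer) => x H.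
    apply: le_trans (H (u x) (Du x)).
    by rewrite lerDl mulr_ge0 ?powR_ge0// ltW.
  - have [u0 [Du0 [u0H u0D u0fin]]] := f_fin.
    apply: le_lt_trans (u_le _ _ _ uDu u0H u0D) _.
    by move: u0fin; rewrite fin_numE ltey => /andP[].
(* Only c = 1 and c = - 1 are used: the competitors u + t c phi with t > 0 give
   the two inequalities. *)
have one_sided (c : R) :
    (leb R n).-integrable setT (EFin \o (fun x => c * h x)) /\
    0 <= \int[leb R n]_x (c * h x).
  pose t (k : nat) : R := k.+1%:R^-1.
  have t0 k : 0 < t k by rewrite invr_gt0.
  have t1 k : t k <= 1 by rewrite invf_le1 ?ler1n.
  have tc : t @ \oo --> (0 : R) by exact: cvg_harmonic.
  pose psi (x : lebRd R n) := c * phi x.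
  pose eta (x : lebRd R n) := c *: frac_grad s phi x.
  have psiL : psi \in Lfun (leb R n) p%:E.
    rewrite (_ : psi = fun x => phi x * c); first exact: (Lfun_scale c p1' phiL).
    by apply/funext => x; rewrite mulrC.
  have etaL i : (fun x : lebRd R n => eta x 0 i) \in Lfun (leb R n) p%:E.
    rewrite (_ : (fun x => _) = fun x : lebRd R n => frac_grad s phi x 0 i * c).
      exact: (Lfun_scale c p1' (DphiL i)).
    by apply/funext => x; rewrite coordZ.
  pose S (x : lebRd R n) := increment_size (u x) (psi x) (Du x) (eta x).
  have SL : S \in Lfun (leb R n) p%:E.
    apply: Lfun_add => //; first by apply: Lfun_add => //; exact: Lfun_normr.
    by apply: Lfun_add => //; apply: Lfun_sum => // i; exact: Lfun_normr.
  have S0 x : 0 <= S x by rewrite !addr_ge0// sumr_ge0.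
  pose G (x : lebRd R n) := 2 * (2 * `|C| + 1) * S x `^ p +
    (`|gamma2 x| `^ (p / (p - 1)) + `|gamma3 x| `^ (p / (p - 1))).
  have q1 := ltW (conjugate_exponent_gt1 p1).
  have Gi : (leb R n).-integrable setT (EFin \o G).
    have Si := integrableZl measurableT (2 * (2 * `|C| + 1)) (Lfun_integrable p1' SL).
    have gi := integrableD measurableT (Lfun_integrable q1 gamma2L)
      (Lfun_integrable q1 gamma3L).
    have := integrableD measurableT Si gi.
    apply: eq_integrable; first exact: measurableT.
    by move=> x _; rewrite /= /G (ger0_norm (S0 x)).
  have limE x : c * h x = derive1 (fun z => f x z (Du x)) (u x) * psi x +
      dotv (grad (f x (u x)) (Du x)) (eta x).
    by rewrite dotvZr /h mulrDr mulrCA.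
  apply: (@directional_derivative_ge0 _ _ _ _ (@leb_complete R n) f0 _ G
    (fun k x => f x (u x + t k * psi x) (Du x + t k *: eta x)) t t0 f0i).
  - move=> k; apply: (measurable_superposition f_meas) => [|i].
      exact: (measurable_funD mu
        (measurable_funM (measurable_cst (t k)) (Lfun_measurable psiL))).
    under eq_fun do rewrite coord_addZ.
    exact: (measurable_funD (mDu i)
      (measurable_funM (measurable_cst (t k)) (Lfun_measurable (etaL i)))).
  - exact: Gi.
  - apply: (ae_imply (ae_and f_diff (ae_and fz_growth fxi_growth))).
    move=> x [dF [Fz Fxi]] k.
    have tk : 0 <= t k <= 1 by rewrite (ltW (t0 k)) t1.
    exact: (increment_le p1 (u x) (psi x) (Du x) (eta x) dF Fz Fxi tk).
  - apply: (ae_imply (ae_and f_diff f_conv)) => x [dF cF].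
    rewrite limE; apply: (@chain_rule_along_ray R n (f x)) => //.
      by move=> xi'; exact: (dF _ _).1.
    exact: (dF _ _).2.
  - move=> k; have := u_le Du _ _ uDu
      (Hspg_perturb s01 p1 (t k * c) uH uDu phiT)
      (is_frac_grad_perturb s01 p1 (t k * c) uL uDu phiT).
    rewrite /Fs; congr (_ <= _)%E; apply: eq_integral => x _.
    by rewrite /psi /eta mulrA scalerA.
have [hi h_ge0] := one_sided 1.
have {}hi : (leb R n).-integrable setT (EFin \o h).
  apply: eq_integrable hi; first exact: measurableT.
  by move=> x _; rewrite /= mul1r.
split => //.
have [_ h_le0] := one_sided (- 1).
rewrite (RintegralZl _ measurableT hi) mul1r in h_ge0.
rewrite (RintegralZl _ measurableT hi) mulN1r oppr_ge0 in h_le0.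
by apply/eqP; rewrite eq_le h_le0 h_ge0.
Qed.
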